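(* Let $A:\operatorname{D}(A)\to\mathcal H$ be a self-adjoint operator on a Hilbert space $\mathcal H$. Let $J\subset\mathbb R$ be a bounded open segment such that $J\cap\sigma(A)\subseteq\sigma_{\mathrm{disc}}(A)$. Let $\{\phi_k\}_{k=1}^{\tilde m}$ be a (finite) family of eigenvectors of $A$ such that $\operatorname{Span}\{\phi_k\}_{k=1}^{\tilde m}=\mathcal E_J(A)$. For fixed $t\in J$, there exist constants $\tilde\varepsilon_t>0$ and $C_t^->0$, independent of the trial space $\mathcal L$, ensuring the following. Let $\mathcal L\subset\operatorname{D}(A)$ be a finite-dimensional subspace with $\mathcal L\cap\ker(A-t)=\{0\}$. If there are $\{w_j\}_{j=1}^{\tilde m}\subset\mathcal L$ such that $$\left(\sum_{j=1}^{\tilde m}\|w_j-\phi_j\|^2+|w_j-\phi_j|_t^2\right)^{1/2}\leq\varepsilon<\tilde\varepsilon_t,$$ then $$0\le\nu_j^-(t)-\left(t+\frac{1}{\tau_j^-(t)}\right)\le C_t^-\varepsilon^2$$ for all $j\le n^-(t)$ such that $\nu_j^-(t)\in J$.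
   Context: $\sigma_{\mathrm{disc}}(A)$ is the discrete spectrum of $A$; $\mathcal E_J(A)=\bigoplus_{\lambda\in J}\ker(A-\lambda)$; $|u|_t=\|(A-t)u\|$ for $u\in\operatorname{D}(A)$. With $\mathbb 1_I(A)$ the spectral projector of $A$ on the Borel set $I$ and $\operatorname{Tr}\mathbb 1_I(A)=\dim\mathbb 1_I(A)\mathcal H$, $$\nu_j^-(t)=\sup\{s<t:\operatorname{Tr}\mathbb 1_{(s,t)}(A)\ge j\}$$ is the $j$th spectral point of $A$ strictly to the left of $t$, counting multiplicity ($-\infty$ if there is no such $s$). Consider the problem of finding $u\in\mathcal L\setminus\{0\}$ and $\tau\in\mathbb R$ such that $\tau\langle (A-t)u,(A-t)v\rangle=\langle (A-t)u,v\rangle$ for all $v\in\mathcal L$. Its negative eigenvalues, counted with multiplicity, are $\tau_1^-(t)\le\dots\le\tau^-_{n^-(t)}(t)<0$, where $n^-(t)$ is their number. *)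

(* Defs.v *)
From HB Require Import structures.
From mathcomp Require Export all_boot all_order all_algebra.
From mathcomp Require Export complex.
From mathcomp Require Export all_classical all_reals all_analysis.

Set Implicit Arguments.
Unset Strict Implicit.
Unset Printing Implicit Defensive.

Export Order.TTheory GRing.Theory Num.Theory.
Export numFieldNormedType.Exports.

Global Open Scope classical_set_scope.
Global Open Scope ring_scope.
Global Open Scope complex_scope.

(** Complex Hilbert spaces.  The inner product is linear in its first and
    conjugate-linear in its second argument. *)

HB.mixin Record CompleteNormedModule_isHilbert (R : realType) (H : Type)
    of CompleteNormedModule R[i] H := {
  inner : {dot H for (@Num.conj R[i])} ;
  inner_normE : forall u : H, inner u u = `|u| ^+ 2 }.

#[short(type="hilbertType")]
HB.structure Definition Hilbert (R : realType) :=
  { H of CompleteNormedModule R[i] H & CompleteNormedModule_isHilbert R H }.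

Notation "''[' u , v ]" := (inner u v) : ring_scope.

Section LinearAlgebra.
Context {R : realType} {H : hilbertType R}.

(* In [R[i]]-normed spaces [`|u|] is an element of [R[i]]; this is the same
   number, seen in [R]. *)
Definition hnorm (u : H) : R := complex.Re `|u|.

Definition lin_span (S : set H) : set H :=
  [set u | exists n (c : 'I_n -> R[i]) (v : 'I_n -> H),
     (forall i, S (v i)) /\ u = \sum_(i < n) c i *: v i].

Definition lin_indep n (v : 'I_n -> H) : Prop :=
  forall c : 'I_n -> R[i],
    \sum_(i < n) c i *: v i = 0 -> forall i, c i = 0.

Definition finite_dim (S : set H) : Prop :=
  exists n (v : 'I_n -> H), S `<=` lin_span (range v).

(* The dimension of a subspace, with all infinite cardinals identified with
   [+oo]. *)
Definition dim (S : set H) : \bar R :=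
  ereal_sup [set n%:R%:E | n in
    [set n : nat | exists v : 'I_n -> H, (forall i, S (v i)) /\ lin_indep v]].

End LinearAlgebra.

(** Operators that need not be everywhere defined: the values of [op] outside
    [dom] are irrelevant. *)
Record operator {R : realType} (H : hilbertType R) := Operator {
  dom : set H ;
  op :> H -> H ;
  dom_submod : submod_closed [in dom] ;
  op_linear : forall (a : R[i]) u v, dom u -> dom v ->
    op (a *: u + v) = a *: op u + op v }.

Section Spectrum.
Context {R : realType} {H : hilbertType R}.
Implicit Types (A : operator H) (u v w : H) (z : R[i]) (t : R).

(* [A] is densely defined and equal, domain included, to its adjoint: the left
   side of the equivalence says that [u] is in the domain of the adjoint and
   is mapped to [w]. *)
Definition self_adjoint A : Prop :=
  dense (dom A) /\
  forall u w, (forall v, dom A v -> '[A v, u] = '[v, w]) <->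
              (dom A u /\ A u = w).

Definition shift A z u : H := A u - z *: u.

Definition ker A z : set H := [set u | dom A u /\ shift A z u = 0].

Definition eigenvector A u : Prop := u != 0 /\ exists z, ker A z u.

Definition resolvent_set A : set (R[i]^o) :=
  [set z | exists B : {linear H -> H},
     [/\ continuous B,
         forall v, dom A (B v) /\ shift A z (B v) = v &
         forall u, dom A u -> B (shift A z u) = u]].

Definition spectrum A : set (R[i]^o) := ~` resolvent_set A.

(* Isolated points of the spectrum that are eigenvalues of finite
   multiplicity. *)
Definition discrete_spectrum A : set (R[i]^o) :=
  [set z | [/\ isolated (spectrum A) z,
               exists2 u, u != 0 & ker A z u &
               finite_dim (ker A z)]].

Definition eigen_sum A (J : set R) : set H :=
  lin_span (\bigcup_(lambda in J) ker A lambda%:C).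

(* The seminorm |u|_t. *)
Definition tnorm A t u : R := hnorm (shift A t%:C u).

(* [E] is the spectral measure of [A]: a projection-valued measure on the Borel
   sets of [R] with A equal to the integral of x dE(x), domain included. *)
Definition diag_measure (E : set R -> H -> H) u (B : set R) : \bar R :=
  (hnorm (E B u) ^+ 2)%:E.

Record is_spectral_measure A (E : set R -> H -> H) : Prop := {
  spm_linear : forall B, measurable B -> linear (E B) ;
  spm_idem : forall B u, measurable B -> E B (E B u) = E B u ;
  spm_sym : forall B u v, measurable B -> '[E B u, v] = '[u, E B v] ;
  spm_total : forall u, E setT u = u ;
  spm_sigma_additive : forall B : (set R)^nat,
    (forall n, measurable (B n)) -> trivIset setT B ->
    forall u, (fun n => \sum_(i < n) E (B i) u) @ \oo -->
              E (\bigcup_n B n) u ;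
  spm_dom : forall u,
    dom A u <-> (\int[diag_measure E u]_x (x ^+ 2)%:E < +oo)%E ;
  spm_op : forall u, dom A u ->
    '[A u, u] = (fine (\int[diag_measure E u]_x x%:E))%:C }.

(* By the spectral theorem a self-adjoint [A] has exactly one spectral measure
   (as far as values on Borel sets are concerned), so that the default value
   of [xget] is then irrelevant. *)
Definition spectral_projector A : set R -> H -> H :=
  xget (fun _ _ => 0) [set E | is_spectral_measure A E].

(* The trace of an orthogonal projector. *)
Definition Tr (P : H -> H) : \bar R := dim (range P).

Definition nu_minus A (j : nat) t : \bar R :=
  ereal_sup [set s%:E | s in [set s : R |
    s < t /\ (j%:R%:E <= Tr (spectral_projector A `]s, t[))%E]].

Definition trial_eigenspace A (L : set H) t (tau : R) : set H :=
  [set u | L u /\ forall v, L v ->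
     tau%:C * '[shift A t%:C u, shift A t%:C v] = '[shift A t%:C u, v]].

Definition is_neg_eigenvalues A (L : set H) t (s : seq R) : Prop :=
  [/\ sorted <=%R s,
      all (fun tau => tau < 0) s &
      forall tau, tau < 0 ->
        dim (trial_eigenspace A L t tau) = (count_mem tau s)%:R%:E].

(* The list is unique; it exists as soon as [L] is a finite-dimensional
   subspace of [dom A] that meets [ker A t] trivially. *)
Definition neg_eigenvalues A (L : set H) t : seq R :=
  xget [::] [set s | is_neg_eigenvalues A L t s].

Definition n_minus A (L : set H) t : nat := size (neg_eigenvalues A L t).

(* Numbered from [j = 1]. *)
Definition tau_minus A (L : set H) t (j : nat) : R :=
  nth 0 (neg_eigenvalues A L t) j.-1.

End Spectrum.

(* Main.v *)
From HB Require Import structures.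
Require Import Defs.
From mathcomp Require Import ring lra spectral sesquilinear measurable_realfun.

Set Implicit Arguments.
Unset Strict Implicit.
Unset Printing Implicit Defensive.

(** Write [T = A - t] and let [tau] be the [j]th negative eigenvalue of the
    trial problem.  If [A] had no spectral measure, all the traces that define
    the spectral points would vanish and none of these points would lie in the
    interval; so fix a spectral measure [E].

    Everything rests on the sign of the form
    [<(A - t) u, (A - s) u> = |T u|^2 + (t - s) <T u, u>] for [s < t]: since
    [(x - t) (x - s)] is negative exactly on [(s, t)], the form is nonnegative
    when [E (s, t) u = 0] and nonpositive when [E (s, t) u = u]
    ([rinner_shift_ge0], [rinner_shift_le0]).  On an eigenvector of the trial
    problem the same form is [(1 + (t - s) tau) |T u|^2], so both bounds on
    [nu - t - 1 / tau] amount to bounds on [1 + (t - s) tau] for [s] near [nu].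
    They are obtained through the min-max principle ([ritz_minmax]): some
    [j]-dimensional subspace of the trial space satisfies
    [<T u, u> <= tau |T u|^2], and the combinations of any [j] trial vectors
    include one with nonzero coefficients and the reverse inequality.

    Lower bound ([lower_estimate]).  If the spectral point [nu] were smaller
    than [t + 1 / tau], choose [s] between them.  The projection [E (s, t)] has
    rank less than [j], so it kills a nonzero vector of the first subspace, on
    which the form is then both nonnegative and negative.

    Upper bound ([upper_estimate]).  For [s] slightly to the left of [nu] the
    projection [E (s, t)] has rank at least [j].  Its range consists of sums of
    eigenvectors with eigenvalues in the interval ([range_proj_eigen_sum]),
    hence of combinations of the [phi k], with coefficients that can be chosen
    linear and bounded ([bounded_coordinates]); replacing each [phi k] by [w k]
    turns such a [u] into a trial vector [z] with [|z - u|] and [|T (z - u)|] of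
    order [eps |u|].  The form splits along [E (s, t)].  The inner component of
    [z] contributes a nonpositive amount, and the outer component of [z] is that
    of [z - u], so its contribution is quadratic in [z - u]: this is why the
    error is of order [eps ^ 2] and not [eps] ([quasimode_form]).  As there is a
    gap in the spectrum just to the left of [t] ([spectral_gap]), [|T z|]
    dominates [|u|], and the min-max principle gives
    [1 + (t - s) tau <= C eps ^ 2].  Divide by [- tau] and let [s] tend to
    [nu].

    The facts about [E] come from two properties of its quadratic form:
    [<A u, u>] is additive along orthogonal spectral subspaces, so that [E B]
    commutes with [A] ([op_proj]), and it is bounded by the end points of [B] on
    the range of [E B], which yields two-sided bounds for [|(A - c) u|]
    ([shift_upper], [shift_lower]). *)

(** * The real inner product *)

Section InnerProduct.
Context {R : realType} {H : hilbertType R}.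
Implicit Types (u v w : H) (r : R) (z : R[i]).

(** The form of the underlying real Hilbert space, to which all the inequalities
    refer. *)
Definition rinner u v : R := complex.Re '[u, v].

Lemma innerC u v : '[u, v] = ('[v, u])^*%C.
Proof. by rewrite hermC /= expr0 mul1r. Qed.

Lemma innerZl z u v : '[z *: u, v] = z * '[u, v].
Proof. exact: linearZl_LR. Qed.

Lemma innerZr z u v : '[u, z *: v] = z^*%C * '[u, v].
Proof. by rewrite innerC innerZl rmorphM /= -innerC. Qed.

Lemma innerDr u v w : '[u, v + w] = '[u, v] + '[u, w].
Proof. exact: linearDr. Qed.

Lemma innerBl u v w : '[u - v, w] = '[u, w] - '[v, w].
Proof. exact: linearBl. Qed.

Lemma inner_suml I s (P : pred I) (F : I -> H) v :
  '[\sum_(i <- s | P i) F i, v] = \sum_(i <- s | P i) '[F i, v].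
Proof. exact: linear_sumlz. Qed.

Lemma inner_sumr I s (P : pred I) (F : I -> H) v :
  '[v, \sum_(i <- s | P i) F i] = \sum_(i <- s | P i) '[v, F i].
Proof. exact: linear_sumr. Qed.

Lemma inner0l u : '[0, u] = 0.
Proof. exact: linear0l. Qed.

Lemma inner0r u : '[u, 0] = 0.
Proof. exact: linear0r. Qed.

Lemma normE u : `|u| = (hnorm u)%:C.
Proof.
have := normr_ge0 u; rewrite /hnorm; case: `|u| => x y.
by rewrite lecE /= => /andP[/eqP -> _].
Qed.

Lemma hnorm_ge0 u : 0 <= hnorm u.
Proof. by rewrite -lecR -normE normr_ge0. Qed.

Lemma inner_hnorm u : '[u, u] = (hnorm u ^+ 2)%:C.
Proof. by rewrite inner_normE normE rmorphXn. Qed.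

Lemma rinner_hnorm u : rinner u u = hnorm u ^+ 2.
Proof. by rewrite /rinner inner_hnorm. Qed.

Lemma hnorm0 : hnorm (0 : H) = 0.
Proof. by rewrite /hnorm normr0. Qed.

Lemma hnorm_eq0 u : hnorm u = 0 -> u = 0.
Proof. by move=> h; apply/eqP; rewrite -normr_eq0 normE h. Qed.

Lemma hnorm_gt0 u : u != 0 -> 0 < hnorm u.
Proof.
move=> u0; rewrite lt_neqAle hnorm_ge0 andbT eq_sym.
by apply: contra_neq u0 => /hnorm_eq0.
Qed.

Lemma ler_hnormD u v : hnorm (u + v) <= hnorm u + hnorm v.
Proof. by rewrite -lecR rmorphD /= -!normE ler_normD. Qed.

Lemma hnormN u : hnorm (- u) = hnorm u.
Proof. by rewrite /hnorm normrN. Qed.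

Lemma hnormB_sym u v : hnorm (u - v) = hnorm (v - u).
Proof. by rewrite -opprB hnormN. Qed.

Lemma hnormZ z u : hnorm (z *: u) = complex.Re `|z| * hnorm u.
Proof.
rewrite /hnorm normrZ normE [`|z|](_ : _ = (complex.Re `|z|)%:C).
  by rewrite -rmorphM.
by rewrite normc_def.
Qed.

Lemma hnormZr r u : 0 <= r -> hnorm (r%:C *: u) = r * hnorm u.
Proof. by move=> r0; rewrite hnormZ ger0_norm ?lecR. Qed.

Lemma ler_hnorm_sum n (F : 'I_n -> H) :
  hnorm (\sum_i F i) <= \sum_i hnorm (F i).
Proof.
elim/big_rec2: _ => [|i x y _ h]; first by rewrite hnorm0.
by apply: le_trans (ler_hnormD _ _) _; rewrite lerD2l.
Qed.

Lemma rinnerC u v : rinner u v = rinner v u.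
Proof. by rewrite /rinner innerC; case: ('[v, u]). Qed.

Lemma rinnerDl u v w : rinner (u + v) w = rinner u w + rinner v w.
Proof. by rewrite /rinner linearDl raddfD. Qed.

Lemma rinnerDr u v w : rinner u (v + w) = rinner u v + rinner u w.
Proof. by rewrite rinnerC rinnerDl !(rinnerC u). Qed.

Lemma rinnerNl u v : rinner (- u) v = - rinner u v.
Proof. by rewrite /rinner linearNl raddfN. Qed.

Lemma rinnerNr u v : rinner u (- v) = - rinner u v.
Proof. by rewrite rinnerC rinnerNl rinnerC. Qed.

Lemma rinnerZl r u v : rinner (r%:C *: u) v = r * rinner u v.
Proof. by rewrite /rinner innerZl; case: ('[u, v]) => x y /=; ring. Qed.

Lemma rinnerZr r u v : rinner u (r%:C *: v) = r * rinner u v.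
Proof. by rewrite rinnerC rinnerZl rinnerC. Qed.

Lemma hnorm_sqrD u v :
  hnorm (u + v) ^+ 2 = hnorm u ^+ 2 + 2 * rinner u v + hnorm v ^+ 2.
Proof.
by rewrite -!rinner_hnorm !rinnerDl !rinnerDr (rinnerC v u); ring.
Qed.

Lemma rinner_CS u v : rinner u v <= hnorm u * hnorm v.
Proof.
have [->|v0] := eqVneq v 0; first by rewrite hnorm0 mulr0 /rinner linear0r.
have [->|u0] := eqVneq u 0.
  by rewrite hnorm0 mul0r /rinner linear0l.
have hu := hnorm_gt0 u0; have hv := hnorm_gt0 v0.
have := sqr_ge0 (hnorm ((hnorm v)%:C *: u + - ((hnorm u)%:C *: v))).
rewrite hnorm_sqrD hnormN !hnormZr ?hnorm_ge0// rinnerNr rinnerZl rinnerZr.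
move=> h; rewrite -subr_ge0 -(pmulr_rge0 _ (mulr_gt0 hu hv)).
nra.
Qed.

(** Conjugate-linearity in the second argument recovers the imaginary part. *)
Lemma inner_real u v : '[u, v] = (rinner u v)%:C + (rinner u ('i *: v))%:C * 'i.
Proof.
rewrite /rinner innerZr; case: ('[u, v]) => x y /=.
by rewrite /real_complex_def; simpc.
Qed.

Lemma le_hnorm_sqr u v : hnorm u ^+ 2 <= hnorm v ^+ 2 -> hnorm u <= hnorm v.
Proof. by rewrite ler_sqr ?nnegrE ?hnorm_ge0. Qed.

End InnerProduct.

(** * Subspaces, spans and operators *)

Section Subspace.
Context {R : realType} {H : hilbertType R} (S : set H).
Hypothesis hS : submod_closed [in S].

Lemma subspace0 : S 0.
Proof. by have [/set_mem] := hS. Qed.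

Lemma subspaceP z u v : S u -> S v -> S (z *: u + v).
Proof.
by move=> /mem_set Su /mem_set Sv; apply/set_mem; case: hS => _; exact.
Qed.

Lemma subspaceD u v : S u -> S v -> S (u + v).
Proof. by move=> Su Sv; rewrite -[u]scale1r; exact: subspaceP. Qed.

Lemma subspaceZ z u : S u -> S (z *: u).
Proof.
by move=> Su; rewrite -[_ *: _]addr0; apply: subspaceP => //; exact: subspace0.
Qed.

Lemma subspaceN u : S u -> S (- u).
Proof. by rewrite -scaleN1r; exact: subspaceZ. Qed.

Lemma subspaceB u v : S u -> S v -> S (u - v).
Proof. by move=> Su /subspaceN; exact: subspaceD. Qed.

Lemma subspace_sum n (c : 'I_n -> R[i]) (v : 'I_n -> H) :
  (forall i, S (v i)) -> S (\sum_i c i *: v i).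
Proof.
move=> Sv; elim/big_rec: _ => [|i x _ Sx]; first exact: subspace0.
exact: subspaceP.
Qed.

Section LinearOn.
Context (F : H -> H).
Hypothesis linF : forall z u v, S u -> S v -> F (z *: u + v) = z *: F u + F v.

Lemma lin_on0 : F 0 = 0.
Proof.
have := linF 1 subspace0 subspace0; rewrite !scale1r addr0 => /eqP.
by rewrite -subr_eq0 opprD addrA subrr sub0r oppr_eq0 => /eqP.
Qed.

Lemma lin_onZ z u : S u -> F (z *: u) = z *: F u.
Proof.
move=> Su; rewrite -[in LHS](addr0 (z *: u)) linF// ?lin_on0 ?addr0//.
exact: subspace0.
Qed.

Lemma lin_onD u v : S u -> S v -> F (u + v) = F u + F v.
Proof. by move=> Su Sv; rewrite -[in LHS](scale1r u) linF// scale1r. Qed.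

Lemma lin_onN u : S u -> F (- u) = - F u.
Proof. by move=> Su; rewrite -scaleN1r lin_onZ// scaleN1r. Qed.

Lemma lin_onB u v : S u -> S v -> F (u - v) = F u - F v.
Proof. by move=> Su Sv; rewrite lin_onD ?lin_onN//; exact: subspaceN. Qed.

Lemma lin_on_sum n (c : 'I_n -> R[i]) (v : 'I_n -> H) :
  (forall i, S (v i)) -> F (\sum_i c i *: v i) = \sum_i c i *: F (v i).
Proof.
move=> Sv.
suff /(_ predT): forall P : pred 'I_n, S (\sum_(i | P i) c i *: v i) /\
    F (\sum_(i | P i) c i *: v i) = \sum_(i | P i) c i *: F (v i) by case.
move=> P; elim/big_rec2: _ => [|i x y _ [Sy Fy]].
  by split; [exact: subspace0 | exact: lin_on0].
by split; [exact: subspaceP | rewrite linF// Fy].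
Qed.

End LinearOn.
End Subspace.

Section Span.
Context {R : realType} {H : hilbertType R} (S : set H).

Lemma lin_span_submod : submod_closed [in lin_span S].
Proof.
split=> [|z u v /set_mem uS /set_mem vS]; apply/mem_set.
  by exists 0%N, (fun=> 0), (fun=> 0); split=> [[]//|]; rewrite big_ord0.
case: uS => n [c [x [Sx ->]]]; case: vS => p [d [y [Sy ->]]].
exists (n + p)%N,
  (fun i => match fintype.split i with inl k => z * c k | inr k => d k end),
  (fun i => match fintype.split i with inl k => x k | inr k => y k end); split.
  by move=> i; case: (fintype.split i).
rewrite big_split_ord scaler_sumr; congr (_ + _); apply: eq_bigr => i _.
  by rewrite (unsplitK (inl i)) scalerA.
by rewrite (unsplitK (inr i)).
Qed.

Lemma sub_lin_span : S `<=` lin_span S.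
Proof.
move=> u Su; exists 1%N, (fun=> 1), (fun=> u); split=> //.
by rewrite big_ord1 scale1r.
Qed.

End Span.

(** Several of the chosen vectors may be the same [v i]; their coefficients
    are collected on [i]. *)
Lemma lin_span_range {R : realType} {H : hilbertType R} n (v : 'I_n -> H) u :
  lin_span (range v) u -> exists c : 'I_n -> R[i], u = \sum_i c i *: v i.
Proof.
move=> [p [d [x [vx ->]]]].
have /choice[g xg] : forall k, exists i, x k = v i.
  by move=> k; have [i _ <-] := vx k; exists i.
exists (fun i => \sum_(k | g k == i) d k).
under [RHS]eq_bigr do rewrite scaler_suml.
rewrite (exchange_big_dep predT)//=; apply: eq_bigr => k _.
by rewrite (big_pred1 (g k)) ?xg// => i; rewrite eq_sym.
Qed.

Section Operator.
Context {R : realType} {H : hilbertType R} (A : operator H).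
Hypothesis Asa : self_adjoint A.
Implicit Types (u v w : H) (t s : R) (z : R[i]).

Let domA := dom_submod A.

Lemma shift_linear s z u v : dom A u -> dom A v ->
  shift A s%:C (z *: u + v) = z *: shift A s%:C u + shift A s%:C v.
Proof.
move=> du dv; rewrite /shift op_linear// scalerDr scalerBr !scalerA.
by rewrite opprD (mulrC s%:C z) addrACA.
Qed.

(** Half of the equivalence that defines self-adjointness. *)
Lemma op_sym u v : dom A u -> dom A v -> '[A u, v] = '[u, A v].
Proof. by move=> du dv; have [_ /(_ v (A v))[_]] := Asa; exact. Qed.

Lemma shift_sym s u v : dom A u -> dom A v ->
  '[shift A s%:C u, v] = '[u, shift A s%:C v].
Proof.
move=> du dv; rewrite /shift linearBl linearBr/= op_sym// innerZl innerZr.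
by congr (_ - _ * _); rewrite conjc_real.
Qed.

Lemma shift_rsym s u v : dom A u -> dom A v ->
  rinner (shift A s%:C u) v = rinner u (shift A s%:C v).
Proof. by move=> du dv; rewrite /rinner shift_sym. Qed.

Lemma shiftE s t u : shift A s%:C u = shift A t%:C u + (t - s)%:C *: u.
Proof. by rewrite /shift rmorphB scalerBl addrA subrK. Qed.

Lemma ker_shift z u : ker A z u -> A u = z *: u.
Proof. by case=> _ /eqP; rewrite subr_eq0 => /eqP. Qed.

Lemma ker_real z u : u != 0 -> ker A z u -> z = (complex.Re z)%:C.
Proof.
move=> u0 [du] /eqP; rewrite subr_eq0 => /eqP Au.
have := op_sym du du; rewrite Au innerZl innerZr.
have nz : '[u, u] != 0 by rewrite dnorm_eq0.
move=> /(mulIf nz); case: z {Au} => x y /= [] /eqP.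
by rewrite -subr_eq0 opprK -mulr2n mulrn_eq0 /= => /eqP ->.
Qed.

Lemma ker_ortho (x y : R) u v : x != y -> ker A x%:C u -> ker A y%:C v ->
  '[u, v] = 0.
Proof.
move=> xy ku kv; have := op_sym ku.1 kv.1.
rewrite (ker_shift ku) (ker_shift kv) innerZl innerZr conjc_real.
move=> /eqP; rewrite -subr_eq0 -mulrBl -rmorphB mulf_eq0 => /orP[|/eqP//].
by rewrite eq_complex /= eqxx andbT subr_eq0 (negPf xy).
Qed.

End Operator.

(** * Projection-valued measures *)

(** The norm of [H] takes values in [R[i]]; this brings limits down to [R]. *)
Lemma cvg_hnorm {R : realType} {H : hilbertType R} (f : nat -> H) (l : H) :
  f @ \oo --> l ->
  forall e : R, 0 < e -> \forall n \near \oo, hnorm (l - f n) < e.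
Proof.
move=> /cvgrPdist_lt fl e e0.
have e0' : 0 < e%:C by rewrite ltcR.
near=> n; rewrite -ltcR -normE.
by near: n; exact: fl.
Unshelve. all: by end_near. Qed.

Section Projections.
Context {R : realType} {H : hilbertType R} (A : operator H) (E : set R -> H -> H).
Hypothesis hE : is_spectral_measure A E.
Implicit Types (u v w : H) (B : set R) (z : R[i]).

Lemma projP B z u v : measurable B -> E B (z *: u + v) = z *: E B u + E B v.
Proof. by move=> mB; exact: (spm_linear hE mB). Qed.

Lemma projD B u v : measurable B -> E B (u + v) = E B u + E B v.
Proof. by move=> mB; rewrite -{1}[u]scale1r projP// scale1r. Qed.

Lemma proj_0 B : measurable B -> E B 0 = 0.
Proof.
by move=> mB; apply: (@addrI _ (E B 0)); rewrite -projD// !addr0.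
Qed.

Lemma projZ B z u : measurable B -> E B (z *: u) = z *: E B u.
Proof. by move=> mB; rewrite -{1}[_ *: u]addr0 projP// proj_0// addr0. Qed.

Lemma projN B u : measurable B -> E B (- u) = - E B u.
Proof. by move=> mB; rewrite -scaleN1r projZ// scaleN1r. Qed.

Lemma projB B u v : measurable B -> E B (u - v) = E B u - E B v.
Proof. by move=> mB; rewrite projD// projN. Qed.

(** The partial sums for the constant family [set0] are the multiples of
    [E set0 u], and these can converge only if it vanishes. *)
Lemma proj_set0 u : E set0 u = 0.
Proof.
apply: contrapT => /eqP/hnorm_gt0 x0.
have t0 : trivIset setT (fun _ : nat => set0 : set R).
  by move=> i j _ _; rewrite setI0 => -[].
have := spm_sigma_additive hE (fun _ : nat => measurable0) t0 (u := u).
move=> /cvg_hnorm/(_ _ x0)[N _ /(_ N.+2) h]; move: h => /(_ _)/wrap[].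
  exact: leqW (leqnSn N).
rewrite bigcup0// sumr_const card_ord hnormB_sym mulrS addrAC subrr add0r.
rewrite -scaler_nat hnormZ normr_nat => h.
have : 1 * hnorm (E set0 u) <= complex.Re (N.+1%:R : R[i]) * hnorm (E set0 u).
  rewrite ler_wpM2r ?hnorm_ge0//.
  have -> : N.+1%:R = N.+1%:R%:C :> R[i] by rewrite rmorph_nat.
  by rewrite /= ler1n.
by rewrite mul1r leNgt h.
Qed.

(** The two sets are completed by empty ones into a sequence. *)
Lemma proj_setU B B' u : measurable B -> measurable B' -> B `&` B' = set0 ->
  E (B `|` B') u = E B u + E B' u.
Proof.
move=> mB mB' BB'.
have mF n : measurable (bigcup2 B B' n) by case: n => [|[|n]] /=.
have tF : trivIset setT (bigcup2 B B').
  by rewrite -trivIset_bigcup2.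
have := spm_sigma_additive hE mF tF (u := u); rewrite bigcup2E => /cvg_hnorm h.
apply: contrapT => /eqP; rewrite -subr_eq0 => /hnorm_gt0 x0.
have [N _ /(_ N.+2)] := h _ x0; move=> /(_ _)/wrap[].
  exact: leqW (leqnSn N).
rewrite !big_ord_recl/= big1 => [|i _]; last by rewrite proj_set0.
by rewrite addr0 ltxx.
Qed.

(** Purely algebraic: the sum of the two idempotents [P] and [Q] is idempotent,
    so [P Q + Q P = 0]; multiplying by [P] on either side gives [P Q = Q P],
    whence [2 P Q = 0]. *)
Lemma proj_ortho B B' u : measurable B -> measurable B' -> B `&` B' = set0 ->
  E B (E B' u) = 0.
Proof.
move=> mB mB' BB'.
have mU : measurable (B `|` B') by exact: measurableU.
have h x : E B (E B' x) + E B' (E B x) = 0.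
  have := spm_idem hE x mU.
  rewrite !proj_setU// !projD// !(spm_idem hE)// => /eqP.
  rewrite -subr_eq0 opprD addrACA [_ + E B (E B' x)]addrC addrK.
  by rewrite addrK => /eqP.
have /eqP := h u; rewrite addrC addr_eq0 => /eqP b.
have := congr1 (E B) (h u); rewrite projD// proj_0// (spm_idem hE)// => /eqP.
rewrite addrC addr_eq0 => /eqP c.
have := h (E B u); rewrite (spm_idem hE)// c b => /eqP.
by rewrite -opprD oppr_eq0 -mulr2n -scaler_nat scaler_eq0 pnatr_eq0 => /eqP.
Qed.

Lemma proj_setI B B' u : measurable B -> measurable B' ->
  E B (E B' u) = E (B `&` B') u.
Proof.
move=> mB mB'.
have mI := measurableI _ _ mB mB'; have mD := measurableD mB' mB.
have mD' := measurableD mB mB'.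
have -> : E B' u = E (B `&` B') u + E (B' `\` B) u.
  rewrite -proj_setU//; first by rewrite (setIC B) setUIDK.
  by apply/seteqP; split=> x //= [[? ?] []].
rewrite projD// (proj_ortho _ mB mD) ?addr0; last first.
  by apply/seteqP; split=> x //= [? []].
have e x : E B x = E (B `&` B') x + E (B `\` B') x.
  rewrite -proj_setU//; first by rewrite setUIDK.
  by apply/seteqP; split=> y //= [[? ?] []].
rewrite e (spm_idem hE)// proj_ortho// ?addr0//.
by apply/seteqP; split=> x //= [[? ?] []].
Qed.

Lemma proj_comm B B' u : measurable B -> measurable B' ->
  E B (E B' u) = E B' (E B u).
Proof. by move=> mB mB'; rewrite !proj_setI// setIC. Qed.

Lemma proj_compl B u : measurable B -> E B u + E (~` B) u = u.
Proof.
move=> mB; rewrite -proj_setU ?setICr ?setUv ?(spm_total hE)//.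
exact: measurableC.
Qed.

(** Being in the range of [E B], and being annihilated by the complementary
    projection, are used interchangeably to localize a vector in [B]. *)
Lemma proj_compl_eq0 B u : measurable B -> E B u = u <-> E (~` B) u = 0.
Proof.
move=> mB; have e := proj_compl u mB; split=> h.
  by apply: (@addrI _ (E B u)); rewrite e addr0.
by rewrite -[RHS]e h addr0.
Qed.

Lemma inner_disjoint B B' u v : measurable B -> measurable B' ->
  B `&` B' = set0 -> '[E B u, E B' v] = 0.
Proof.
by move=> mB mB' BB'; rewrite (spm_sym hE)// proj_ortho// linear0r.
Qed.

Lemma hnorm_projU B B' u : measurable B -> measurable B' -> B `&` B' = set0 ->
  hnorm (E (B `|` B') u) ^+ 2 = hnorm (E B u) ^+ 2 + hnorm (E B' u) ^+ 2.
Proof.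
move=> mB mB' BB'; rewrite proj_setU// hnorm_sqrD /rinner inner_disjoint//=.
by rewrite mulr0 addr0.
Qed.

Lemma hnorm_compl B u : measurable B ->
  hnorm u ^+ 2 = hnorm (E B u) ^+ 2 + hnorm (E (~` B) u) ^+ 2.
Proof.
move=> mB; rewrite -hnorm_projU ?setICr ?setUv ?(spm_total hE)//.
exact: measurableC.
Qed.

Lemma hnorm_proj_le B u : measurable B -> hnorm (E B u) <= hnorm u.
Proof.
by move=> mB; apply: le_hnorm_sqr; rewrite (hnorm_compl u mB) lerDl sqr_ge0.
Qed.

End Projections.

(** * Diagonal measures and the quadratic form *)

Section SpectralMeasure.
Context {R : realType} {H : hilbertType R} (A : operator H) (E : set R -> H -> H).
Implicit Types (u v w : H) (B : set R) (z : R[i]).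

(** A copy of [diag_measure] that carries the hypothesis on [E], on which its
    structure of finite measure depends. *)
Definition scalar_measure (hE : is_spectral_measure A E) u : set R -> \bar R :=
  diag_measure E u.

Context (hE : is_spectral_measure A E).

Let scalar_measure0 u : scalar_measure hE u set0 = 0%E.
Proof. by rewrite /scalar_measure /diag_measure (proj_set0 hE) hnorm0 expr0n. Qed.

Let scalar_measure_ge0 u B : (0 <= scalar_measure hE u B)%E.
Proof. by rewrite lee_fin sqr_ge0. Qed.

Let hnorm_projsum (F : nat -> set R) u n :
  (forall i, measurable (F i)) -> trivIset setT F ->
  hnorm (\sum_(i < n) E (F i) u) ^+ 2 = \sum_(i < n) hnorm (E (F i) u) ^+ 2.
Proof.
move=> mF tF; elim: n => [|n ih]; first by rewrite !big_ord0 hnorm0 expr0n.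
rewrite !big_ord_recr /= hnorm_sqrD ih (_ : rinner _ _ = 0) ?mulr0 ?addr0//.
rewrite /rinner inner_suml big1// => i _.
rewrite (inner_disjoint hE)//.
by move/trivIsetP : tF; apply=> //; rewrite ltn_eqF.
Qed.

Let scalar_measure_sigma u : semi_sigma_additive (scalar_measure hE u).
Proof.
move=> F mF tF mUF.
have /cvg_hnorm h := spm_sigma_additive hE mF tF (u := u).
rewrite (_ : (fun n => _) =
    (fun n => (hnorm (\sum_(i < n) E (F i) u) ^+ 2)%:E)); last first.
  by apply/funext => n; rewrite hnorm_projsum// big_mkord -sumEFin.
apply: cvg_EFin; first by near=> n.
under eq_fun do rewrite /= expr2.
rewrite /scalar_measure /diag_measure /= expr2.
suff: hnorm (\sum_(i < n) E (F i) u) @[n --> \oo] -->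
      hnorm (E (\bigcup_n F n) u) by move=> c; exact: cvgM.
apply/cvgrPdist_lt => e /h; apply: filterS => n; apply: le_lt_trans.
set x := E _ _; set y := \sum_(i < n) _.
have h1 := ler_hnormD (x - y) y; have h2 := ler_hnormD (y - x) x.
rewrite (hnormB_sym y x) in h2; rewrite !subrK in h1 h2.
by rewrite ler_norml; apply/andP; split; lra.
Unshelve. all: by end_near. Qed.

HB.instance Definition _ u := isMeasure.Build _ _ _ (scalar_measure hE u)
  (scalar_measure0 u) (scalar_measure_ge0 u) (@scalar_measure_sigma u).

Let scalar_measure_fin u : fin_num_fun (scalar_measure hE u).
Proof. by []. Qed.

HB.instance Definition _ u := Measure_isFinite.Build _ _ _ (scalar_measure hE u)
  (@scalar_measure_fin u).

Let mid : measurable_fun setT (fun x : R => x%:E).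
Proof. exact/measurable_EFinP. Qed.

Let msq : measurable_fun setT (fun x : R => (x ^+ 2)%:E).
Proof. by apply/measurable_EFinP; exact: exprn_measurable. Qed.

Lemma dom_integrable_sq u :
  dom A u <-> (scalar_measure hE u).-integrable setT (fun x : R => (x ^+ 2)%:E).
Proof.
split=> [/(spm_dom hE) h|/integrableP[_ h]].
  apply/integrableP; split; first exact: msq.
  by under eq_integral do rewrite gee0_abs ?lee_fin ?sqr_ge0//.
apply/(spm_dom hE); move: h.
by under eq_integral do rewrite gee0_abs ?lee_fin ?sqr_ge0//.
Qed.

(** On a finite measure [x] is integrable as soon as [x ^ 2] is. *)
Lemma dom_integrable u :
  dom A u -> (scalar_measure hE u).-integrable setT (fun x : R => x%:E).
Proof.
move=> /dom_integrable_sq h.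
have h1 := finite_measure_integrable_cst (scalar_measure hE u) 1 (measurableT).
have := integrableD measurableT h h1; apply: (le_integrable _ mid) => //.
move=> x _ /=; rewrite lee_fin [leRHS]ger0_norm ?addr_ge0 ?sqr_ge0//.
rewrite ler_norml; apply/andP; split.
  by have := sqr_ge0 (x + 1); have := sqr_ge0 x; nra.
by have := sqr_ge0 (x - 1); have := sqr_ge0 x; nra.
Qed.

Lemma rinner_integral u : dom A u ->
  (rinner (A u) u)%:E = (\int[scalar_measure hE u]_x x%:E)%E.
Proof.
move=> du; rewrite /rinner (spm_op hE du)/= fineK//.
exact: integrable_fin_num (dom_integrable du).
Qed.

Lemma scalar_measure_proj_le B u B' : measurable B -> measurable B' ->
  (scalar_measure hE (E B u) B' <= scalar_measure hE u B')%E.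
Proof.
move=> mB mB'; rewrite /scalar_measure /diag_measure lee_fin.
by rewrite (proj_comm hE)// ler_sqr ?nnegrE ?hnorm_ge0 ?(hnorm_proj_le hE).
Qed.

(** Projecting can only decrease the diagonal measure, hence the second moment
    that defines the domain. *)
Lemma dom_proj B u : measurable B -> dom A u -> dom A (E B u).
Proof.
move=> mB /(spm_dom hE) h; apply/(spm_dom hE); apply: le_lt_trans h.
apply: (@ge0_le_measure_integral _ _ _ (scalar_measure hE (E B u))
  (scalar_measure hE u)) => //.
  by move=> B' mB'; exact: scalar_measure_proj_le.
by move=> x; rewrite lee_fin sqr_ge0.
Qed.

Lemma scalar_measure_null B u : E B u = 0 -> scalar_measure hE u B = 0%E.
Proof. by move=> h; rewrite /scalar_measure /diag_measure h hnorm0 expr0n. Qed.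

Lemma scalar_measure_total B u :
  E B u = u -> scalar_measure hE u B = (hnorm u ^+ 2)%:E.
Proof. by move=> h; rewrite /scalar_measure /diag_measure h. Qed.

Lemma integral_in B u (f : R -> \bar R) : measurable B -> E B u = u ->
  (scalar_measure hE u).-integrable setT f ->
  (\int[scalar_measure hE u]_x f x = \int[scalar_measure hE u]_(x in B) f x)%E.
Proof.
move=> mB /(proj_compl_eq0 hE _ mB) Bu fi.
rewrite (negligible_integral (measurableC mB))//.
  by rewrite setTD setCK.
  exact: scalar_measure_null.
Qed.

Lemma dom_bounded B u (M : R) : measurable B -> E B u = u ->
  (forall x, B x -> `|x| <= M) -> dom A u.
Proof.
move=> mB Bu BM; apply/(spm_dom hE).
have /(proj_compl_eq0 hE _ mB) u0 := Bu.
rewrite (@ge0_negligible_integral _ _ _ (scalar_measure hE u) _ (~` B))//; first last.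
- exact: scalar_measure_null.
- by move=> x _; rewrite lee_fin sqr_ge0.
- exact: measurableC.
rewrite setTD setCK.
apply: (@le_lt_trans _ _ (\int[scalar_measure hE u]_(x in B) (M ^+ 2)%:E)%E).
  apply: ge0_le_integral => //.
  - by move=> x _; rewrite lee_fin sqr_ge0.
  - by apply: measurable_funS msq.
  - move=> x /BM; rewrite lee_fin -real_normK ?num_real// => h.
    by rewrite lerXn2r ?nnegrE// (le_trans _ h).
rewrite integral_cst// -ge0_fin_numE.
  by rewrite fin_numM// fin_num_measure.
by rewrite mule_ge0// lee_fin sqr_ge0.
Qed.

Lemma rinner_ge_in B u (c : R) : measurable B -> E B u = u -> dom A u ->
  (forall x, B x -> c <= x) -> c * hnorm u ^+ 2 <= rinner (A u) u.
Proof.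
move=> mB Bu du Bc; rewrite -lee_fin rinner_integral//.
rewrite (integral_in mB Bu); last exact: dom_integrable.
have -> : (c * hnorm u ^+ 2)%:E = (\int[scalar_measure hE u]_(x in B) c%:E)%E.
  by rewrite integral_cst//= scalar_measure_total.
apply: le_integral => //.
- exact: finite_measure_integrable_cst.
- exact: integrableS (dom_integrable du).
- by move=> x /set_mem Bx; rewrite lee_fin Bc.
Qed.

Lemma rinner_le_in B u (c : R) : measurable B -> E B u = u -> dom A u ->
  (forall x, B x -> x <= c) -> rinner (A u) u <= c * hnorm u ^+ 2.
Proof.
move=> mB Bu du Bc; rewrite -lee_fin rinner_integral//.
rewrite (integral_in mB Bu); last exact: dom_integrable.
have -> : (c * hnorm u ^+ 2)%:E = (\int[scalar_measure hE u]_(x in B) c%:E)%E.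
  by rewrite integral_cst//= scalar_measure_total.
apply: le_integral => //.
- exact: integrableS (dom_integrable du).
- exact: finite_measure_integrable_cst.
- by move=> x /set_mem Bx; rewrite lee_fin Bc.
Qed.

(** The diagonal measure of the sum of two vectors localized in complementary
    sets is the sum of their diagonal measures. *)
Lemma rinner_add u v B : measurable B -> dom A u -> dom A v ->
  E B u = u -> E B v = 0 ->
  rinner (A (u + v)) (u + v) = rinner (A u) u + rinner (A v) v.
Proof.
move=> mB du dv Bu Bv.
have duv : dom A (u + v) by exact: (subspaceD (dom_submod A)).
apply: EFin_inj; rewrite EFinD !rinner_integral//.
rewrite -integral_measure_add//; try exact: dom_integrable.
apply: eq_measure_integral => B' mB' _.
transitivity (scalar_measure hE u B' + scalar_measure hE v B')%E; last first.
  by rewrite -measure_addE.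
change (diag_measure E (u + v)%R B' = diag_measure E u B' + diag_measure E v B')%E.
rewrite /diag_measure -EFinD (projD hE)// hnorm_sqrD.
rewrite (_ : rinner _ _ = 0) ?mulr0 ?addr0//.
rewrite /rinner -Bu (proj_comm hE)// (spm_sym hE)// (proj_comm hE)// Bv.
by rewrite (proj_0 hE)// inner0r.
Qed.

End SpectralMeasure.

(** * Spectral localization of vectors *)

Section Localization.
Context {R : realType} {H : hilbertType R} (A : operator H) (E : set R -> H -> H).
Hypotheses (Asa : self_adjoint A) (hE : is_spectral_measure A E).
Implicit Types (u v w : H) (B : set R) (z : R[i]) (c r s t : R).

Let domA := dom_submod A.

Let op_rcross u v B : measurable B -> dom A u -> dom A v ->
  E B u = u -> E B v = 0 -> rinner (A u) v = 0.
Proof.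
move=> mB du dv Bu Bv; have := rinner_add hE mB du dv Bu Bv.
rewrite (lin_onD (@op_linear _ _ A))// !rinnerDl !rinnerDr.
have -> : rinner (A v) u = rinner (A u) v.
  by rewrite {1}/rinner op_sym// -/(rinner v (A u)) rinnerC.
by move=> h; lra.
Qed.

(** Additivity of the quadratic form kills the real part of the polar form, and
    replacing [v] by ['i *: v] kills the imaginary part. *)
Lemma op_cross u v B : measurable B -> dom A u -> dom A v ->
  E B u = u -> E B v = 0 -> '[A u, v] = 0.
Proof.
move=> mB du dv Bu Bv; rewrite inner_real !(op_rcross mB du)//.
- by rewrite mul0r addr0.
- exact: (subspaceZ domA).
- by rewrite (projZ hE)// Bv scaler0.
Qed.

Let op_projl u v B : measurable B -> dom A u -> dom A v ->
  '[A (E B u), v] = '[A (E B u), E B v].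
Proof.
move=> mB du dv; have mC := measurableC mB.
rewrite -{1}(proj_compl hE v mB) innerDr.
rewrite (@op_cross (E B u) (E (~` B) v) B) ?addr0//.
- exact: (dom_proj hE).
- exact: (dom_proj hE).
- exact: (spm_idem hE).
- by rewrite (proj_ortho hE)// setICr.
Qed.

(** By the vanishing of the cross terms, [E B (A u)] satisfies the relation that
    characterizes the value of the adjoint at [E B u]. *)
Lemma op_proj u B : measurable B -> dom A u -> A (E B u) = E B (A u).
Proof.
move=> mB du; have [_ /(_ (E B u) (E B (A u)))[h _]] := Asa.
suff /h[] : forall v, dom A v -> '[A v, E B u] = '[v, E B (A u)] by [].
move=> v dv; have dEv := dom_proj hE mB dv; have dEu := dom_proj hE mB du.
rewrite -[RHS](spm_sym hE)// -[RHS](op_sym Asa)// (op_projl mB dv du).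
by rewrite op_sym// innerC (op_projl mB du dv) -innerC -op_sym.
Qed.

Lemma shift_proj u B s : measurable B -> dom A u ->
  shift A s%:C (E B u) = E B (shift A s%:C u).
Proof.
by move=> mB du; rewrite /shift op_proj// (projB hE)// (projZ hE).
Qed.

(** The norm of a symmetric operator is controlled by its quadratic form, here
    bounded by [r |v|^2] on the range of [E B].  Polarization is applied to [u]
    and a multiple of [g = (A - c) u], which stays in that range because
    [E B] commutes with [A]. *)
Lemma shift_upper B u c r : measurable B -> E B u = u -> dom A u -> 0 <= r ->
  (forall x, B x -> `|x - c| <= r) -> hnorm (shift A c%:C u) <= r * hnorm u.
Proof.
move=> mB Bu du r0 Br.
have lo x : B x -> c - r <= x by move/Br; rewrite ler_norml; lra.
have up x : B x -> x <= c + r by move/Br; rewrite ler_norml; lra.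
have form v : dom A v -> E B v = v ->
    `|rinner (shift A c%:C v) v| <= r * hnorm v ^+ 2.
  move=> dv Bv; rewrite /shift rinnerDl rinnerNl rinnerZl rinner_hnorm.
  have := rinner_ge_in hE mB Bv dv lo; have := rinner_le_in hE mB Bv dv up.
  by rewrite ler_norml => h1 h2; apply/andP; split; nra.
set g := shift A c%:C u.
have Bg : E B g = g by rewrite -shift_proj// Bu.
have dg : dom A g.
  apply: (dom_bounded (M := `|c| + r) hE mB Bg) => x /Br xr.
  by have := ler_normD (x - c) c; rewrite subrK; lra.
have [->|g0] := eqVneq g 0; first by rewrite hnorm0 mulr_ge0 ?hnorm_ge0.
have [u0|u0] := eqVneq u 0.
  by move: g0; rewrite /g u0 (lin_on0 domA (shift_linear _))// eqxx.
have hg := hnorm_gt0 g0; have hu := hnorm_gt0 u0.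
(* the weight for which [u] and [l g] have the same norm is the optimal one *)
pose l : R := hnorm u / hnorm g.
have l0 : 0 < l by rewrite divr_gt0.
have dlg : dom A (l%:C *: g) by exact: (subspaceZ domA).
have Blg : E B (l%:C *: g) = l%:C *: g by rewrite (projZ hE)// Bg.
pose k := shift A c%:C (l%:C *: g).
have ku : rinner k u = l * hnorm g ^+ 2.
  by rewrite shift_rsym// rinnerZl rinner_hnorm.
have := form (u + l%:C *: g) (subspaceD domA du dlg).
rewrite (projD hE)// Bu Blg => /(_ erefl).
have := form (u - l%:C *: g) (subspaceB domA du dlg).
rewrite (projB hE)// Bu Blg => /(_ erefl).
rewrite (lin_onB domA (shift_linear c))// (lin_onD (shift_linear c))//.
rewrite -/g -/k !hnorm_sqrD hnormN (hnormZr _ (ltW l0)) rinnerNr rinnerZr.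
clearbody k g; rewrite !(rinnerDl, rinnerDr, rinnerNl, rinnerNr).
rewrite ku !rinnerZr rinner_hnorm.
have lg : l * hnorm g = hnorm u by rewrite /l mulfVK// gt_eqF.
rewrite lg !ler_norml => /andP[h1 _] /andP[_ h2].
have h : l * hnorm g ^+ 2 <= r * hnorm u ^+ 2 by nra.
rewrite expr2 mulrA lg expr2 mulrA (mulrC r) -mulrA ler_pM2l// in h.
Qed.

(** Split [u = p + q] into its parts to the right and to the left of the gap.
    The form of [A - c] is at least [r |p|^2] on [p] and at most [- r |q|^2] on
    [q], so pairing [(A - c) u] with [p - q], which has the norm of [u], gives at
    least [r |u|^2]. *)
Lemma shift_lower u c r : 0 <= r -> dom A u -> E `]c - r, c + r[ u = 0 ->
  r * hnorm u <= hnorm (shift A c%:C u).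
Proof.
move=> r0 du Iu.
pose Bp : set R := `[c + r, +oo[%classic; pose Bm : set R := `]-oo, c - r]%classic.
have mBp : measurable Bp by exact: measurable_itv.
have mBm : measurable Bm by exact: measurable_itv.
have mI : measurable (`]c - r, c + r[%classic : set R) by exact: measurable_itv.
set p := E Bp u; set q := E (~` Bp) u.
have upq : u = p + q by rewrite (proj_compl hE).
have dp : dom A p by exact: (dom_proj hE).
have dq : dom A q by apply: (dom_proj hE) => //; exact: measurableC.
have Bpp : E Bp p = p by exact: (spm_idem hE).
have Bpq : E Bp q = 0.
  by rewrite (proj_ortho hE) ?setICr//; exact: measurableC.
have Bmq : E Bm q = q.
  apply/(proj_compl_eq0 hE _ mBm); rewrite /q (proj_setI hE); first last.
  - exact: measurableC.
  - exact: measurableC.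
  rewrite (_ : _ `&` _ = `]c - r, c + r[%classic)//.
  have BpE x : Bp x = (c + r <= x) by rewrite /Bp/= in_itv/= andbT.
  have BmE x : Bm x = (x <= c - r) by rewrite /Bm/= in_itv/=.
  apply/seteqP; split=> x; rewrite /setI /setC /= BpE BmE in_itv/=.
    by move=> [/negP + /negP]; rewrite -!ltNge => -> ->.
  by move=> /andP[h1 h2]; split; apply/negP; rewrite -ltNge.
have cross v w : dom A v -> dom A w -> E Bp v = v -> E Bp w = 0 ->
    rinner (shift A c%:C v) w = 0.
  move=> dv dw Bv Bw; rewrite /shift rinnerDl rinnerNl rinnerZl.
  rewrite /rinner (op_cross mBp dv dw Bv Bw) -[in X in _ * X]Bv (spm_sym hE)//.
  by rewrite Bw inner0r /= mulr0 subr0.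
have pos : r * hnorm p ^+ 2 <= rinner (shift A c%:C p) p.
  have := rinner_ge_in hE mBp Bpp dp (c := c + r).
  rewrite /shift rinnerDl rinnerNl rinnerZl rinner_hnorm => /(_ _)/wrap[].
    by move=> x; rewrite /Bp/= in_itv/= andbT.
  by move=> h; nra.
have neg : rinner (shift A c%:C q) q <= - r * hnorm q ^+ 2.
  have := rinner_le_in hE mBm Bmq dq (c := c - r).
  rewrite /shift rinnerDl rinnerNl rinnerZl rinner_hnorm => /(_ _)/wrap[].
    by move=> x; rewrite /Bm/= in_itv/=.
  by move=> h; nra.
have pq0 : rinner p q = 0.
  by rewrite -Bpp /rinner (spm_sym hE)// Bpq inner0r.
have hu : hnorm u ^+ 2 = hnorm p ^+ 2 + hnorm q ^+ 2.
  by rewrite upq hnorm_sqrD pq0 mulr0 addr0.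
have hy : hnorm (p - q) = hnorm u.
  apply/eqP; rewrite -(eqrXn2 (n := 2)) ?hnorm_ge0// hu.
  by rewrite hnorm_sqrD rinnerNr pq0 hnormN oppr0 mulr0 addr0.
have qp : rinner (shift A c%:C q) p = 0.
  by rewrite (shift_rsym Asa)// rinnerC cross.
have := rinner_CS (shift A c%:C u) (p - q).
rewrite hy {1}upq (lin_onD (shift_linear c))// rinnerDl !rinnerDr !rinnerNr.
rewrite (cross p q)// qp oppr0 addr0 add0r => h.
have [u0|u0] := eqVneq u 0; first by rewrite u0 hnorm0 mulr0 hnorm_ge0.
by rewrite -(ler_pM2r (hnorm_gt0 u0)); nra.
Qed.

(** [(x - t) (x - s) = (x - c)^2 - r^2] for [c] the midpoint of [s] and [t] and
    [r] half their distance. *)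
Lemma rinner_shift_shift s t u :
  rinner (shift A t%:C u) (shift A s%:C u) =
  hnorm (shift A ((s + t) / 2)%:C u) ^+ 2 - ((t - s) / 2) ^+ 2 * hnorm u ^+ 2.
Proof.
rewrite (shiftE A t ((s + t) / 2)) (shiftE A s ((s + t) / 2)).
move: (shift A ((s + t) / 2)%:C u) => g.
rewrite !(rinnerDl, rinnerDr) !rinnerZl !rinnerZr !rinner_hnorm (rinnerC u g).
by field.
Qed.

Lemma rinner_shift_ge0 s t u : s < t -> dom A u -> E `]s, t[ u = 0 ->
  0 <= rinner (shift A t%:C u) (shift A s%:C u).
Proof.
move=> st du Eu; rewrite rinner_shift_shift subr_ge0 -exprMn.
rewrite ler_sqr ?nnegrE ?hnorm_ge0 ?mulr_ge0 ?hnorm_ge0//; try lra.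
apply: shift_lower => //; first lra.
by rewrite (_ : _ - _ = s); [rewrite (_ : _ + _ = t)//; field|field].
Qed.

Lemma dom_itv s t u : E `]s, t[ u = u -> dom A u.
Proof.
move=> Eu; apply: (dom_bounded (M := `|s| + `|t|) hE _ Eu).
  exact: measurable_itv.
move=> x /=; rewrite in_itv/= => /andP[sx xt].
by rewrite ler_norml; have := ler_norm t; have := ler_norm (- s);
  rewrite normrN; have := normr_ge0 s; have := normr_ge0 t; lra.
Qed.

Lemma rinner_shift_le0 s t u : s < t -> E `]s, t[ u = u ->
  rinner (shift A t%:C u) (shift A s%:C u) <= 0.
Proof.
move=> st Eu; rewrite rinner_shift_shift subr_le0 -exprMn.
rewrite ler_sqr ?nnegrE ?hnorm_ge0 ?mulr_ge0 ?hnorm_ge0//; try lra.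
apply: (shift_upper _ Eu); [exact: measurable_itv|exact: dom_itv Eu|lra|].
by move=> x /=; rewrite in_itv/= => /andP[sx xt]; rewrite ler_norml; lra.
Qed.

End Localization.

(** * The discrete part of the spectrum *)

Lemma pos_gap_seq (R : realDomainType) (s : seq R) :
  exists2 d, 0 < d & forall x, x \in s -> 0 < x -> d <= x.
Proof.
elim: s => [|y s [d d0 ds]]; first by exists 1.
have [y0|y0] := ltP 0 y; last first.
  by exists d => // x; rewrite inE => /orP[/eqP ->|/ds//]; rewrite ltNge y0.
exists (Num.min d y); first by rewrite lt_min d0.
move=> x; rewrite inE ge_min => /orP[/eqP -> _|xs x0]; first by rewrite lexx orbT.
by rewrite ds.
Qed.

Section DiscretePart.
Context {R : realType} {H : hilbertType R} (A : operator H) (E : set R -> H -> H).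
Hypotheses (Asa : self_adjoint A) (hE : is_spectral_measure A E).
Implicit Types (u v w : H) (B : set R) (z : R[i]) (c r s t x : R).

Lemma proj_null_sub B B' u : measurable B -> measurable B' -> B' `<=` B ->
  E B u = 0 -> E B' u = 0.
Proof.
move=> mB mB' /setIidl BB' Bu.
by rewrite -BB' -(proj_setI hE)// Bu (proj_0 hE).
Qed.

Lemma bounded_of_continuous (B : {linear H -> H}) : continuous B ->
  exists2 M : R, 0 < M & forall u, hnorm (B u) <= M * hnorm u.
Proof.
move=> /linear_bounded_continuous/linear_boundedP[M [Mr h]].
exists (`|complex.Re M| + 1) => [|u]; first by rewrite ltr_wpDl.
have /h/(_ u) : M < (`|complex.Re M| + 1)%:C.
  have {1}-> : M = (complex.Re M)%:C by apply/esym/eqP; rewrite RRe_real.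
  by rewrite ltcR ltr_pwDr// ler_norm.
by rewrite !normE -rmorphM lecR.
Qed.

(** Vectors localized near [x] are almost in the kernel of [A - x], which a
    bounded inverse forbids. *)
Lemma resolvent_null x : resolvent_set A x%:C ->
  exists2 r, 0 < r & forall u, E `]x - r, x + r[ u = 0.
Proof.
move=> [B [/bounded_of_continuous[M M0 BM] _ Binv]].
pose r := (2 * M)^-1; have r0 : 0 < r by rewrite invr_gt0 mulr_gt0.
exists r => // u; set v := E _ u.
have mI : measurable (`]x - r, x + r[%classic : set R) by exact: measurable_itv.
have Ev : E `]x - r, x + r[ v = v by exact: (spm_idem hE).
have dv := dom_itv hE Ev.
have up : hnorm (shift A x%:C v) <= r * hnorm v.
  apply: (shift_upper Asa hE mI Ev dv (ltW r0)) => y /=.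
  by rewrite in_itv/= ler_norml => /andP[? ?]; lra.
have := BM (shift A x%:C v); rewrite Binv// => h.
apply: hnorm_eq0; apply/eqP; rewrite eq_le hnorm_ge0 andbT.
have h' : hnorm v <= M * (r * hnorm v) by rewrite (le_trans h)// ler_pM2l.
have e : M * (r * hnorm v) = hnorm v / 2 by rewrite /r; field; rewrite gt_eqF.
by rewrite e in h'; lra.
Qed.

Lemma proj_point u x : ker A x%:C (E [set x] u).
Proof.
have m1 : measurable [set x] by [].
have Ev : E [set x] (E [set x] u) = E [set x] u by exact: (spm_idem hE).
have dv : dom A (E [set x] u).
  by apply: (dom_bounded (M := `|x|) hE m1 Ev) => y ->.
split=> //; apply: hnorm_eq0; apply/eqP; rewrite eq_le hnorm_ge0 andbT.
rewrite -[leRHS](mul0r (hnorm (E [set x] u))).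
by apply: (shift_upper Asa hE m1 Ev dv (lexx 0)) => y ->; rewrite subrr normr0.
Qed.

Context (a b : R) (m : nat) (phi : 'I_m -> H).
Hypothesis disc : forall lambda : R, lambda \in `]a, b[ ->
  spectrum A lambda%:C -> discrete_spectrum A lambda%:C.
Hypothesis phi_eig : forall k, eigenvector A (phi k).
Hypothesis phi_span : lin_span (range phi) = eigen_sum A `]a, b[.

Lemma eigenvalues_ex : exists mu : 'I_m -> R, forall k, ker A (mu k)%:C (phi k).
Proof.
suff /choice[mu h] : forall k, exists x, ker A x%:C (phi k) by exists mu.
move=> k; have [p0 [z kz]] := phi_eig k; exists (complex.Re z).
by rewrite -(ker_real Asa p0 kz).
Qed.

Context (mu : 'I_m -> R) (hmu : forall k, ker A (mu k)%:C (phi k)).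

(** An eigenvector for another eigenvalue would be orthogonal to all the
    [phi k], although it lies in their span. *)
Lemma eigenvalue_in_family x u : x \in `]a, b[ -> u != 0 -> ker A x%:C u ->
  exists k, mu k = x.
Proof.
move=> xab u0 ku; apply: contrapT => h; move/eqP: u0; apply.
have : eigen_sum A `]a, b[ u by apply: sub_lin_span; exists x.
rewrite -phi_span => /lin_span_range[c uc].
apply/eqP; rewrite -(@dnorm_eq0 _ _ (@inner R H)); apply/eqP.
rewrite {2}uc inner_sumr big1// => k _; rewrite innerZr.
rewrite (ker_ortho Asa _ ku (hmu k)) ?mulr0//.
by apply/eqP => xk; apply: h; exists k.
Qed.

Lemma resolvent_off_family x : x \in `]a, b[ -> (forall k, mu k != x) ->
  resolvent_set A x%:C.
Proof.
move=> xab hx; apply: contrapT => /(disc xab)[_ [u u0 ku] _].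
have [k /eqP] := eigenvalue_in_family xab u0 ku.
by rewrite (negPf (hx k)).
Qed.

Lemma measurable_family : measurable (range mu).
Proof.
apply: countable_measurable => // .
apply: finite_set_countable; apply: finite_image; exact: finite_finset.
Qed.

(** Every other point of the interval has a null neighbourhood; countably many
    null intervals, those with rational end points, suffice to cover. *)
Lemma proj_off_eigenvalues u : E (`]a, b[ `\` range mu) u = 0.
Proof.
(* [F] enumerates the null intervals with rational end points *)
pose I (p : rat * rat) : set R := `]ratr p.1, ratr p.2[%classic.
have mI p : measurable (I p) by exact: measurable_itv.
pose F n := if unpickle n is Some p then
  if `[< E (I p) u = 0 >] then I p else set0 else set0.
have nF n : (scalar_measure hE u).-negligible (F n).
  rewrite /F; case: (unpickle n) => [p|]; last exact: negligible_set0.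
  case: asboolP => [h|_]; last exact: negligible_set0.
  by apply/negligibleP => //; exact: scalar_measure_null.
have mB : measurable (`]a, b[ `\` range mu).
  by apply: measurableD; [exact: measurable_itv|exact: measurable_family].
have sub : `]a, b[ `\` range mu `<=` \bigcup_n F n.
  move=> x [xab xmu].
  have [|r r0 hr] := @resolvent_null x.
    by apply: resolvent_off_family => // k; apply/eqP => kx; apply: xmu; exists k.
  have [|p] := @rat_in_itvoo R (x - r) x; first by rewrite ltrBlDr ltrDl.
  have [|q] := @rat_in_itvoo R x (x + r); first by rewrite ltrDl.
  rewrite !in_itv/= => /andP[xq qr] /andP[rp px].
  have [n nE] : exists n, unpickle n = Some (p, q).
    by exists (pickle (p, q)); exact: pickleK.
  exists n => //; rewrite /F nE; case: asboolP => [_|[]].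
    by rewrite /I/= in_itv/= px xq.
  apply: (proj_null_sub (B := `]x - r, x + r[%classic)) (hr u) => //.
  move=> y /=; rewrite !in_itv/= => /andP[py yq].
  by rewrite (lt_trans rp py) (lt_trans yq qr).
have := measure_negligible mB (negligibleS sub (negligible_bigcup nF)).
move=> /(congr1 fine) /= /eqP; rewrite sqrf_eq0 => /eqP.
exact: hnorm_eq0.
Qed.

Lemma spectral_gap t : t \in `]a, b[ ->
  exists2 d, 0 < d & forall u, E `]t - d, t[ u = 0.
Proof.
rewrite in_itv/= => /andP[at' tb].
have [d d0 hd] := pos_gap_seq (t - a :: [seq t - mu k | k : 'I_m]).
exists d => // u.
apply: (proj_null_sub _ _ _ (proj_off_eigenvalues u)).
- by apply: measurableD; [exact: measurable_itv|exact: measurable_family].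
- exact: measurable_itv.
move=> x /=; rewrite !in_itv/= => /andP[tx xt]; split.
  have := hd (t - a); rewrite inE eqxx subr_gt0 => /(_ isT at') h.
  by apply/andP; split; lra.
move=> [k _ kx]; have := hd (t - mu k); rewrite kx subr_gt0 => /(_ _ xt)/wrap[].
  by rewrite in_cons; apply/orP; right; apply/mapP; exists k;
    rewrite ?mem_enum ?kx.
by lra.
Qed.

(** The points of [l] are added one at a time; repeated points change nothing. *)
Lemma eigen_sum_point B u (l : seq R) : measurable B -> B `<=` `]a, b[ ->
  eigen_sum A `]a, b[ (E (B `&` [set` l]) u).
Proof.
move=> mB Bab.
have es := @lin_span_submod _ _ (\bigcup_(x in `]a, b[) ker A x%:C).
have ml (s : seq R) : measurable (B `&` [set` s]).
  apply: measurableI => //; apply: countable_measurable => //.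
  by apply: finite_set_countable; exact: finite_seq.
elim: l => [|x l ih].
  by rewrite set_nil setI0 (proj_set0 hE); exact: (subspace0 es).
have [xB|xB] := pselect (B x /\ x \notin l); last first.
  rewrite (_ : B `&` _ = B `&` [set` l])//.
  apply/seteqP; split=> y /= [By]; rewrite ?inE => yl; split=> //; last first.
    by rewrite yl orbT.
  case/orP : yl => // /eqP yx; apply: contrapT => /negP yl; apply: xB.
  by rewrite -yx.
rewrite (_ : B `&` _ = [set x] `|` (B `&` [set` l])); last first.
  apply/seteqP; split=> y /=.
    by move=> [By]; rewrite inE => /orP[/eqP ->|yl]; [left|right].
  by move=> [->|[By yl]]; rewrite inE ?eqxx ?yl ?orbT//; split=> //; exact: xB.1.
rewrite (proj_setU hE)//; last first.
  by apply/seteqP; split=> y //= [-> [_ xl]]; move: xB.2; rewrite xl.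
apply: (subspaceD es) ih; apply: sub_lin_span; exists x; first exact/Bab/xB.1.
exact: proj_point.
Qed.

Lemma range_proj_eigen_sum s t u : a <= s -> t <= b -> E `]s, t[ u = u ->
  eigen_sum A `]a, b[ u.
Proof.
move=> as' tb Eu.
have mI : measurable (`]s, t[%classic : set R) by exact: measurable_itv.
have sub : `]s, t[ `<=` `]a, b[.
  move=> x /=; rewrite !in_itv/= => /andP[? ?].
  by apply/andP; split; lra.
rewrite -Eu -(setUIDK `]s, t[%classic (range mu)) (proj_setU hE); first last.
- by apply/seteqP; split=> y //= [[? ?] []].
- by apply: measurableD => //; exact: measurable_family.
- by apply: measurableI => //; exact: measurable_family.
rewrite (proj_null_sub (B' := `]s, t[ `\` range mu) _ _ _
  (proj_off_eigenvalues u)) ?addr0; first last.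
- by apply: setSD.
- by apply: measurableD => //; exact: measurable_family.
- by apply: measurableD; [exact: measurable_itv|exact: measurable_family].
rewrite (_ : range mu = [set` [seq mu k | k : 'I_m]]).
  exact: eigen_sum_point.
apply/seteqP; split=> [x [k _ <-]|x /= /mapP[k _ ->]]; last by exists k.
by rewrite /= map_f ?mem_enum.
Qed.

End DiscretePart.

(** * Gram-orthonormal bases *)

(** More vectors than linear functionals: a nonzero combination is annihilated
    by all of them.  The functionals are indexed by a predicate [P] so as to
    select Ritz vectors by their eigenvalues. *)
Lemma row_dependent (F : fieldType) (I : finType) (P : pred I) n
    (M : 'I_n -> I -> F) : (#|P| < n)%N ->
  exists c : 'I_n -> F, (exists i, c i != 0) /\
    forall l, P l -> \sum_i c i * M i l = 0.
Proof.
move=> Pn; pose N : 'M[F]_(n, #|P|) := \matrix_(i, l) M i (enum_val l).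
have : kermx N != 0.
  rewrite -mxrank_eq0 mxrank_ker subn_eq0 -ltnNge.
  exact: leq_ltn_trans (rank_leq_col N) Pn.
move=> /rowV0Pn[v /sub_kermxP vN v0].
exists (v 0); split.
  apply: contrapT => h; move/eqP: v0; apply; apply/rowP => i; rewrite mxE.
  by apply: contrapT => /eqP vi; apply: h; exists i.
move=> l Pl; have Pl' : l \in P by [].
have /matrixP/(_ 0 (enum_rank_in Pl' l)) := vN.
rewrite !mxE => e; rewrite -[RHS]e; apply: eq_bigr => i _.
by rewrite mxE enum_rankK_in.
Qed.

Section FiniteDim.
Context {R : realType} {H : hilbertType R}.
Implicit Types (u v w : H).

Lemma lin_indep_card (I : finType) (P : pred I) (f : I -> H) n (v : 'I_n -> H)
    (M : 'I_n -> I -> R[i]) :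
  (forall i, v i = \sum_(l | P l) M i l *: f l) -> lin_indep v ->
  (n <= #|P|)%N.
Proof.
move=> vM iv; rewrite leqNgt; apply/negP => /(row_dependent M)[c [[i ci] cM]].
move/eqP: ci; apply; apply: iv.
under eq_bigr do rewrite vM scaler_sumr.
rewrite exchange_big /= big1// => l Pl.
by under eq_bigr do rewrite scalerA; rewrite -scaler_suml cM// scale0r.
Qed.

Context (S : set H) (G : H -> H).
Hypotheses (hS : submod_closed [in S]) (fS : finite_dim S).
Hypothesis linG : forall z u v, S u -> S v -> G (z *: u + v) = z *: G u + G v.
Hypothesis injG : forall u, S u -> G u = 0 -> u = 0.

(** Orthonormality for the form [<G u, G v>].  [G] is the identity when an
    orthonormal basis is wanted, and [A - t] for the trial problem. *)
Definition gram_orthonormal d (e : 'I_d -> H) :=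
  (forall i, S (e i)) /\ forall i j, '[G (e i), G (e j)] = (i == j)%:R.

Lemma gram_coord d (e : 'I_d -> H) (c : 'I_d -> R[i]) j :
  gram_orthonormal e -> '[G (\sum_i c i *: e i), G (e j)] = c j.
Proof.
move=> [Se oe]; rewrite (lin_on_sum hS linG)// inner_suml (bigD1 j)//=.
rewrite innerZl oe eqxx mulr1 big1 ?addr0// => i ij.
by rewrite innerZl oe (negPf ij) mulr0.
Qed.

Lemma gram_indep d (e : 'I_d -> H) : gram_orthonormal e -> lin_indep e.
Proof.
move=> oe c c0 j; have := gram_coord c j oe.
by rewrite c0 (lin_on0 hS linG) inner0l.
Qed.

Lemma gram_extend d (e : 'I_d -> H) u : gram_orthonormal e -> S u ->
  u != \sum_i '[G u, G (e i)] *: e i ->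
  exists e' : 'I_d.+1 -> H, gram_orthonormal e'.
Proof.
move=> oe Su; have [Se _] := oe; rewrite -subr_eq0; set p := \sum_i _ => r0.
have Sp : S p by exact: (subspace_sum hS).
have Sr : S (u - p) by exact: (subspaceB hS).
set r := u - p in r0 Sr *.
have Gr0 : G r != 0 by apply: contra_neq r0; exact: injG.
have ro j : '[G r, G (e j)] = 0.
  by rewrite /r (lin_onB hS linG)// innerBl gram_coord// subrr.
have hr := hnorm_gt0 Gr0.
pose r' := (hnorm (G r))^-1%:C *: r.
have Sr' : S r' by exact: (subspaceZ hS).
have r'o j : '[G r', G (e j)] = 0.
  by rewrite (lin_onZ hS linG)// innerZl ro mulr0.
exists (fun i => if unlift ord_max i is Some j then e j else r'); split.
  by move=> i; case: unliftP.
move=> i j; case: unliftP => [i' ->|->]; case: unliftP => [j' ->|->].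
- by rewrite (inj_eq (lift_inj)) oe.2.
- by rewrite innerC r'o rmorph0 eq_sym (negPf (neq_lift _ _)).
- by rewrite r'o (negPf (neq_lift _ _)).
- rewrite eqxx (lin_onZ hS linG)// innerZl innerZr inner_hnorm conjc_real.
  by rewrite -!rmorphM /= expr2 mulKf ?gt_eqF// mulVf ?gt_eqF.
Qed.

(** Gram-Schmidt without a recursion: independence bounds the size of an
    orthonormal family, and one of maximal size spans by [gram_extend]. *)
Lemma gram_basis : exists d (e : 'I_d -> H), gram_orthonormal e /\
  forall u, S u -> u = \sum_i '[G u, G (e i)] *: e i.
Proof.
pose Q d := `[< exists e : 'I_d -> H, gram_orthonormal e >].
have Q0 : exists d, Q d.
  by exists 0%N; apply/asboolP; exists (fun=> 0); split=> [[]|[]].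
have [n [v Sv]] := fS.
have Qn d : Q d -> (d <= n)%N.
  move=> /asboolP[e oe].
  have /choice[M eM] : forall i, exists c : 'I_n -> R[i], e i = \sum_l c l *: v l.
    by move=> i; exact/lin_span_range/Sv/oe.1.
  by rewrite -[n in (_ <= n)%N]card_ord;
    apply: (@lin_indep_card 'I_n predT v d e M) (gram_indep oe).
case: (ex_maxnP Q0 Qn) => d /asboolP[e oe] dmax; exists d, e; split=> // u Su.
apply: contrapT => /eqP h; have [e' oe'] := gram_extend oe Su h.
have := dmax d.+1; rewrite ltnn => /(_ _)/wrap[]//.
by apply/asboolP; exists e'.
Qed.

End FiniteDim.

(** * Simultaneous diagonalization *)

Section Diagonalization.
Context {R : realType} {H : hilbertType R}.
Implicit Types (u v w : H).
Context (S : set H) (G Q : H -> H).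
Hypotheses (hS : submod_closed [in S]) (fS : finite_dim S).
Hypothesis linG : forall z u v, S u -> S v -> G (z *: u + v) = z *: G u + G v.
Hypothesis injG : forall u, S u -> G u = 0 -> u = 0.
Hypothesis linQ : forall z u v, S u -> S v -> Q (z *: u + v) = z *: Q u + Q v.
Hypothesis symQ : forall u v, S u -> S v -> '[Q u, v] = '[u, Q v].

(** The spectral theorem for the Hermitian matrix of [<Q e_i, e_j>] in a
    Gram-orthonormal basis; the unitary change of basis preserves Gram
    orthonormality. *)
Lemma gram_diagonalization : exists d (f : 'I_d -> H) (th : 'I_d -> R),
  [/\ gram_orthonormal S G f,
      forall i j, '[Q (f i), f j] = (th i *+ (i == j))%:C &
      forall u, S u -> u = \sum_i '[G u, G (f i)] *: f i].
Proof.
have [d [e [oe eS]]] := gram_basis hS fS linG injG; have [Se ee] := oe.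
pose M : 'M[R[i]]_d := \matrix_(i, j) '[Q (e i), e j].
have hM : M \is hermsymmx.
  apply/is_hermitianmxP; rewrite expr0 scale1r; apply/matrixP => i j.
  by rewrite !mxE symQ// innerC.
pose U := spectralmx M; pose D := spectral_diag M.
have uU : U \is unitarymx := spectral_unitarymx M.
have UU : U *m (map_mx Num.conj U^T) = 1%:M by exact/unitarymxP.
have U'U : (map_mx Num.conj U^T) *m U = 1%:M by exact: mulmx1C.
have MD : M = (map_mx Num.conj U^T) *m diag_mx D *m U.
  by rewrite -invmx_unitary//; apply/orthomx_spectralP; exact: hermitian_normalmx.
have Dr i : D 0 i = (complex.Re (D 0 i))%:C.
  have /mxOverP/(_ 0 i) := hermitian_spectral_diag_real hM.
  by move=> /RRe_real.
pose f i := \sum_k U i k *: e k.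
have Sf i : S (f i) by exact: (subspace_sum hS).
have Gf i : G (f i) = \sum_k U i k *: G (e k) by exact: (lin_on_sum hS linG).
have Qf i : Q (f i) = \sum_k U i k *: Q (e k) by exact: (lin_on_sum hS linQ).
have fe i k : '[G (f i), G (e k)] = U i k by exact: (gram_coord hS linG _ _ oe).
have Ue i k : (map_mx Num.conj U^T) k i = (U i k)^*%C by rewrite !mxE.
exists d, f, (fun i => complex.Re (D 0 i)); split.
- split=> // i j.
  transitivity ((U *m (map_mx Num.conj U^T)) i j); last by rewrite UU mxE.
  rewrite (Gf j) inner_sumr mxE; apply: eq_bigr => k _.
  by rewrite innerZr fe Ue mulrC.
- move=> i j.
  transitivity ((U *m M *m (map_mx Num.conj U^T)) i j); last first.
    rewrite MD !mulmxA UU mul1mx -mulmxA UU mulmx1 mxE.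
    by case: (i == j) => //; rewrite !mulr1n -Dr.
  rewrite {2}/f inner_sumr [RHS]mxE; apply: eq_bigr => k _.
  rewrite innerZr Ue mulrC; congr (_ * _).
  rewrite Qf inner_suml mxE; apply: eq_bigr => l _.
  by rewrite innerZl mxE.
- move=> u Su.
  rewrite [LHS](eS u Su).
  under [RHS]eq_bigr => i _.
    rewrite Gf inner_sumr.
    under eq_bigr do rewrite innerZr.
    rewrite /f scaler_sumr.
    over.
  rewrite [RHS]exchange_big /=; apply: eq_bigr => k _.
  under eq_bigr do rewrite scalerA mulr_suml.
  rewrite -scaler_suml exchange_big /=; congr (_ *: _).
  transitivity (\sum_l '[G u, G (e l)] * (1%:M : 'M[R[i]]_d) l k).
    rewrite (bigD1 k)//= mxE eqxx mulr1 big1 ?addr0// => l lk.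
    by rewrite mxE (negPf lk) mulr0.
  rewrite -U'U; apply: eq_bigr => l _; rewrite mxE mulr_sumr.
  by apply: eq_bigr => i _; rewrite Ue -mulrA mulrCA mulrA.
Qed.

End Diagonalization.

(** * Min-max principle for the trial problem *)

Section Counting.
Context {R : realDomainType}.
Implicit Types (s : seq R).

Lemma count_le_nth s j : sorted <=%R s -> (0 < j <= size s)%N ->
  (j <= count (fun x => (x <= nth 0%R s j.-1)%R) s)%N.
Proof.
case: j => // j ss js; set x := nth 0 s j.
rewrite -(cat_take_drop j.+1 s) count_cat.
have : all (fun y => y <= x) (take j.+1 s).
  apply/(all_nthP 0) => i; rewrite size_takel// => ij.
  rewrite nth_take//; apply: (sorted_leq_nth le_trans le_refl _ ss) => //.
  by rewrite inE (leq_trans ij).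
by rewrite all_count => /eqP ->; rewrite size_takel// leq_addr.
Qed.

Lemma count_lt_nth s j : sorted <=%R s -> (0 < j <= size s)%N ->
  (count (fun x => (x < nth 0%R s j.-1)%R) s < j)%N.
Proof.
case: j => // j ss js; set x := nth 0 s j.
rewrite -(cat_take_drop j s) count_cat ltnS.
have /eqP -> : count (fun y => (y < x)%R) (drop j s) == 0%N.
  rewrite -leqn0 leqNgt -has_count; apply/negP => /(has_nthP 0)[k].
  rewrite size_drop nth_drop ltNge => ij; apply/negP; rewrite negbK.
  apply: (sorted_leq_nth le_trans le_refl _ ss); rewrite ?inE ?leq_addr//.
  by rewrite -ltn_subRL.
by rewrite addn0 (leq_trans (count_size _ _))// size_take_min geq_minl.
Qed.

End Counting.

Section Dimension.
Context {R : realType} {H : hilbertType R}.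

Lemma dim_eq (S : set H) k :
  (exists v : 'I_k -> H, (forall i, S (v i)) /\ lin_indep v) ->
  (forall n (v : 'I_n -> H), (forall i, S (v i)) -> lin_indep v -> (n <= k)%N) ->
  dim S = k%:R%:E.
Proof.
move=> ex ub; apply/eqP; rewrite eq_le; apply/andP; split.
  apply: ge_ereal_sup => _ [n [v [Sv iv]] <-].
  by rewrite lee_fin ler_nat (ub n v).
by apply: ereal_sup_ubound; exists k.
Qed.

(** A supremum of integers that reaches [k] is exceeded or attained by one of
    them; a family that is too large is truncated, the missing coefficients
    being set to zero. *)
Lemma dim_ge_indep (S : set H) k : (k%:R%:E <= dim S)%E ->
  exists v : 'I_k -> H, (forall i, S (v i)) /\ lin_indep v.
Proof.
move=> h; apply: contrapT => nex.
case: k => [|k] in h nex *.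
  by apply: nex; exists (fun=> 0); split=> [[]//|c _ []].
have : (dim S <= k%:R%:E)%E.
  apply: ge_ereal_sup => _ [n [v [Sv iv]] <-]; rewrite lee_fin ler_nat leqNgt.
  apply/negP => kn; apply: nex.
  exists (fun i => v (widen_ord kn i)); split=> // c c0.
  pose d i := \sum_(l | widen_ord kn l == i) c l.
  have d0 : \sum_i d i *: v i = 0.
    rewrite -[RHS]c0; under eq_bigr do rewrite /d scaler_suml.
    rewrite (exchange_big_dep predT)//=; apply: eq_bigr => l _.
    by rewrite (big_pred1 (widen_ord kn l))// => i; rewrite eq_sym.
  move=> i; rewrite -(iv d d0 (widen_ord kn i)) /d (big_pred1 i)//.
by move=> /(le_trans h); rewrite lee_fin ler_nat ltnn.
Qed.

End Dimension.

Section Ritz.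
Context {R : realType} {H : hilbertType R} (A : operator H).
Hypothesis Asa : self_adjoint A.
Context (t : R) (L : set H).
Hypotheses (hL : submod_closed [in L]) (LA : L `<=` dom A) (fL : finite_dim L).
Hypothesis Lker : L `&` ker A t%:C = [set 0].

Local Notation T := (shift A t%:C).

Let linT z u v : L u -> L v -> T (z *: u + v) = z *: T u + T v.
Proof. by move=> /LA du /LA dv; exact: shift_linear. Qed.

Let symT u v : L u -> L v -> '[T u, v] = '[u, T v].
Proof. by move=> /LA du /LA dv; exact: shift_sym. Qed.

Lemma trial_inj u : L u -> T u = 0 -> u = 0.
Proof.
move=> Lu Tu; have : (L `&` ker A t%:C) u by split=> //; split=> //; exact: LA.
by rewrite Lker.
Qed.

Definition sqr_modulus (z : R[i]) : R := complex.Re z ^+ 2 + complex.Im z ^+ 2.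

Lemma sqr_modulus_ge0 z : 0 <= sqr_modulus z.
Proof. by rewrite addr_ge0// sqr_ge0. Qed.

Lemma mul_conjc z : z * z^*%C = (sqr_modulus z)%:C.
Proof.
case: z => x y; apply/eqP; rewrite eq_complex /sqr_modulus /=.
by apply/andP; split; apply/eqP; ring.
Qed.

(** When the family spans [L], it consists of eigenvectors of the trial problem,
    normalized by [|T u| = 1]. *)
Definition ritz_family d (f : 'I_d -> H) (th : 'I_d -> R) :=
  gram_orthonormal L T f /\ forall i j, '[T (f i), f j] = (th i *+ (i == j))%:C.

Lemma ritz_form d (f : 'I_d -> H) th (c : 'I_d -> R[i]) i : ritz_family f th ->
  '[T (f i), \sum_j c j *: f j] = (th i)%:C * (c i)^*%C.
Proof.
move=> [_ fd]; rewrite inner_sumr (bigD1 i)//= innerZr fd eqxx mulr1n mulrC.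
rewrite big1 ?addr0// => j ji; rewrite innerZr fd eq_sym (negPf ji) mulr0n.
by rewrite rmorph0 mulr0.
Qed.

Lemma ritz_expand d (f : 'I_d -> H) th (c : 'I_d -> R[i]) :
  let u := \sum_i c i *: f i in ritz_family f th ->
  hnorm (T u) ^+ 2 = \sum_i sqr_modulus (c i) /\
  rinner (T u) u = \sum_i th i * sqr_modulus (c i).
Proof.
move=> u rf; have [fo fd] := rf.
have Tu : T u = \sum_i c i *: T (f i) by rewrite (lin_on_sum hL linT)//; case: fo.
split.
  rewrite -rinner_hnorm /rinner {1}Tu inner_suml raddf_sum /=.
  apply: eq_bigr => i _; rewrite innerZl innerC.
  by rewrite (gram_coord hL linT)// mul_conjc.
rewrite /rinner {1}Tu inner_suml raddf_sum /=.
apply: eq_bigr => i _; rewrite innerZl (ritz_form _ _ rf) mulrCA mul_conjc.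
by rewrite -rmorphM.
Qed.

Lemma ritz_sub d (f : 'I_d -> H) th k (g : 'I_k -> 'I_d) : injective g ->
  ritz_family f th -> ritz_family (f \o g) (th \o g).
Proof.
move=> gi [[Lf fo] fd]; split; last by move=> i j /=; rewrite fd (inj_eq gi).
by split=> [i|i j] /=; [exact: Lf | rewrite fo (inj_eq gi)].
Qed.

(** Testing the eigenvalue equation against [f l] shows that the coordinate on
    [f l] vanishes unless [th l = tau]. *)
Lemma ritz_trial_dim d (f : 'I_d -> H) th tau : ritz_family f th ->
  (forall u, L u -> u = \sum_i '[T u, T (f i)] *: f i) ->
  dim (trial_eigenspace A L t tau) = #|[pred i | th i == tau]|%:R%:E.
Proof.
move=> rf fc; have [fo fd] := rf; apply: dim_eq.
  have rg := ritz_sub (@enum_val_inj _ [pred i | th i == tau]) rf.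
  exists (f \o enum_val); split; last exact: (gram_indep hL linT rg.1).
  move=> l /=; set i := enum_val l.
  have /eqP thi : th i == tau by have := enum_valP l.
  split=> [|v Lv]; first exact: fo.1.
  by rewrite [in RHS](fc v Lv) (ritz_form _ _ rf) -innerC thi.
move=> n v vt iv.
apply: (@lin_indep_card _ _ _ [pred i | th i == tau] f n v
  (fun i l => '[T (v i), T (f l)])) iv => i.
have [Lv hv] := vt i.
rewrite [LHS](fc _ Lv) (bigID [pred i | th i == tau])/= [X in _ + X]big1 ?addr0//.
move=> l thl; have := hv (f l) (fo.1 l).
have -> : '[T (v i), f l] = (th l)%:C * '[T (v i), T (f l)].
  rewrite (symT Lv (fo.1 l)) innerC [in LHS](fc _ Lv) (ritz_form _ _ rf).
  by rewrite rmorphM; congr (_ * _); [exact: conjc_real | exact: conjcK].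
move=> /eqP; rewrite -subr_eq0 -mulrBl -rmorphB mulf_eq0 => /orP[|/eqP ->].
  by rewrite eq_complex /= eqxx andbT subr_eq0 eq_sym (negPf thl).
by rewrite scale0r.
Qed.

(** The default value of the list is empty, so that it has no [j]th term. *)
Lemma neg_eigenvaluesP j : (1 <= j <= n_minus A L t)%N ->
  is_neg_eigenvalues A L t (neg_eigenvalues A L t).
Proof.
rewrite /n_minus /neg_eigenvalues => hj.
have [[s hs]|nex] := pselect (exists s, is_neg_eigenvalues A L t s).
  exact: (xgetPex _ (ex_intro _ s hs)).
move: hj; rewrite xgetPN; last by move=> s hs; apply: nex; exists s.
by case: j.
Qed.

(** The list of negative eigenvalues is a sorted copy of the negative diagonal
    entries [th].  At least [j] of these are at most [tau], and their Ritz
    vectors span the first space; fewer than [j] are smaller than [tau], and a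
    combination of [j] vectors can be made orthogonal to the corresponding
    Ritz vectors. *)
Lemma ritz_minmax j (tau := tau_minus A L t j) : (1 <= j <= n_minus A L t)%N ->
  [/\ tau < 0,
   exists y : 'I_j -> H, [/\ forall i, L (y i), lin_indep y &
     forall c : 'I_j -> R[i], let u := \sum_i c i *: y i in
       rinner (T u) u <= tau * hnorm (T u) ^+ 2] &
   forall x : 'I_j -> H, (forall i, L (x i)) ->
     exists c : 'I_j -> R[i], (exists i, c i != 0) /\
       let u := \sum_i c i *: x i in
       tau * hnorm (T u) ^+ 2 <= rinner (T u) u].
Proof.
move=> hj; have [ss sneg scount] := neg_eigenvaluesP hj.
move: hj; rewrite /n_minus => hj.
have tauE : tau = nth 0 (neg_eigenvalues A L t) j.-1 by [].
set s := neg_eigenvalues A L t in ss sneg scount hj tauE.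
have [d [f [th [fo fd fc]]]] := gram_diagonalization hL fL linT trial_inj linT symT.
have rf : ritz_family f th by [].
have tau0 : tau < 0.
  rewrite tauE; apply: (allP sneg); apply: mem_nth.
  by case: j hj {tau tauE} => // j /andP[].
have cardE' (P : pred R) : (forall x, P x -> x < 0) ->
    #|[pred i | P (th i)]| = count P s.
  move=> P0; pose ts := [seq th i | i <- enum 'I_d].
  have cts (Q : pred R) : #|[pred i | Q (th i)]| = count Q ts.
    rewrite cardE /enum_mem size_filter count_map /enum_mem count_filter.
    by apply: eq_count => i; rewrite !inE andbT.
  have : perm_eq s (seq.filter (fun x => x < 0) ts).
    apply/allP => x _ /=; rewrite count_filter.
    have [x0|x0] := ltP x 0; last first.
      rewrite (_ : count_mem x s = 0%N); last first.
        apply/count_memPn/negP => /(allP sneg); by rewrite ltNge x0.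
      rewrite eq_sym -leqn0 leqNgt -has_count; apply/negP => /hasP[y _ /=].
      by move=> /andP[/eqP ->]; rewrite ltNge x0.
    have := scount x x0; rewrite (ritz_trial_dim _ rf fc) => -[] /eqP.
    rewrite eqr_nat (cts (pred1 x)) => /eqP <-; apply/eqP.
    by apply: eq_count => y /=; case: eqP => //= ->; rewrite x0.
  move=> /permP/(_ P) ->; rewrite cts count_filter; apply: eq_count => x /=.
  by case Px : (P x) => //=; rewrite P0.
have le_card : (j <= #|[pred i | (th i <= tau)%R]|)%N.
  rewrite (cardE' (fun x => x <= tau)) ?tauE; first exact: count_le_nth.
  by move=> x; rewrite -tauE => /le_lt_trans; exact.
have lt_card : (#|[pred i | (th i < tau)%R]| < j)%N.
  rewrite (cardE' (fun x => (x < tau)%R)) ?tauE; first exact: count_lt_nth.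
  by move=> x; rewrite -tauE => /lt_trans; exact.
split=> //.
  pose g (i : 'I_j) := enum_val (widen_ord le_card i).
  have gi : injective g by move=> i k /enum_val_inj/(congr1 val)/= /val_inj.
  have rg := ritz_sub gi rf.
  exists (f \o g); split; [exact: rg.1.1|exact: (gram_indep hL linT rg.1)|].
  move=> c; have [-> ->] := ritz_expand c rg.
  rewrite mulr_sumr; apply: ler_sum => i _.
  apply: ler_wpM2r; first exact: sqr_modulus_ge0.
  by have := enum_valP (widen_ord le_card i).
move=> x Lx.
have [c [c0 cM]] := row_dependent (fun i l => '[T (x i), T (f l)]) lt_card.
exists c; split=> //=; set u := \sum_i c i *: x i.
have Lu : L u by exact: (subspace_sum hL).
have Tu0 l : th l < tau -> '[T u, T (f l)] = 0.
  move=> /cM <-; rewrite (lin_on_sum hL linT)// inner_suml.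
  by apply: eq_bigr => i _; rewrite innerZl.
clearbody u; rewrite (fc u Lu).
have [-> ->] := ritz_expand (fun i => '[T u, T (f i)]) rf.
rewrite mulr_sumr; apply: ler_sum => l _.
have [/Tu0 ->|h] := ltP (th l) tau.
  by rewrite /sqr_modulus /= !expr0n /= addr0 !mulr0.
by rewrite ler_wpM2r ?sqr_modulus_ge0.
Qed.

End Ritz.

(** * The two one-sided estimates *)

Section Coordinates.
Context {R : realType} {H : hilbertType R}.
Implicit Types (u v w : H).

Lemma Re_norm_ge0 (z : R[i]) : 0 <= complex.Re `|z|.
Proof. by rewrite normc_def /= sqrtr_ge0. Qed.

Lemma hnorm_inner u v : complex.Re `|'[u, v]| <= hnorm u * hnorm v.
Proof.
set z := '[u, v]; set r := complex.Re `|z|.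
have zr : `|z| = r%:C by rewrite /r normc_def.
have [r0|r0] := leP r 0; first by rewrite (le_trans r0)// mulr_ge0 ?hnorm_ge0.
rewrite -(ler_pM2l r0).
have <- : rinner (z^*%C *: u) v = r * r.
  rewrite /rinner innerZl -/z mulrC (_ : z * z^*%C = `|z| ^+ 2); last first.
    by rewrite normCK.
  by rewrite zr -rmorphXn.
apply: (le_trans (rinner_CS _ _)); rewrite hnormZ mulrA ler_wpM2r ?hnorm_ge0//.
rewrite ler_wpM2r ?hnorm_ge0// (_ : `|z^*%C| = `|z|) ?zr//.
exact: norm_conjC.
Qed.

Lemma Re_normM (z z' : R[i]) :
  complex.Re `|z * z'| = complex.Re `|z| * complex.Re `|z'|.
Proof.
rewrite normrM !normc_def /=; by rewrite mulr0 subr0.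
Qed.

Lemma Re_norm_sum n (F : 'I_n -> R[i]) :
  complex.Re `|\sum_i F i| <= \sum_i complex.Re `|F i|.
Proof.
have := ler_norm_sum (index_enum 'I_n) F predT.
by rewrite lecE => /andP[_]; rewrite raddf_sum.
Qed.

(** The [phi k] may be linearly dependent, so coefficients are not unique: expand
    in an orthonormal basis, then write each basis vector once and for all as a
    combination of the [phi k]. *)
Lemma bounded_coordinates m (phi : 'I_m -> H) :
  exists (c : 'I_m -> H -> R[i]) (K : R),
  [/\ 0 <= K,
      forall n (z : 'I_n -> R[i]) (v : 'I_n -> H) k,
        c k (\sum_i z i *: v i) = \sum_i z i * c k (v i),
      forall u, lin_span (range phi) u -> u = \sum_k c k u *: phi k &
      forall k u, complex.Re `|c k u| <= K * hnorm u].
Proof.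
have hS := @lin_span_submod _ _ (range phi).
have fS : finite_dim (lin_span (range phi)) by exists m, phi.
have [||d [e [oe eS]]] := @gram_basis _ _ _ id hS fS => //.
have /choice[M eM] : forall i, exists c : 'I_m -> R[i], e i = \sum_k c k *: phi k.
  by move=> i; exact/lin_span_range/oe.1.
exists (fun k u => \sum_i '[u, e i] * M i k),
  (\sum_k \sum_i complex.Re `|M i k|); split.
- by apply: sumr_ge0 => k _; apply: sumr_ge0 => i _; exact: Re_norm_ge0.
- move=> n z v k; under eq_bigr do rewrite inner_suml mulr_suml.
  rewrite exchange_big /=; apply: eq_bigr => l _.
  by rewrite mulr_sumr; apply: eq_bigr => i _; rewrite innerZl mulrA.
- move=> u Su; rewrite {1}(eS u Su).
  under [RHS]eq_bigr do rewrite scaler_suml.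
  rewrite [RHS]exchange_big /=; apply: eq_bigr => i _.
  by rewrite {2}(eM i) scaler_sumr; apply: eq_bigr => k _; rewrite scalerA.
- move=> k u; rewrite (bigD1 k)//= mulrDl.
  apply: (@le_trans _ _ ((\sum_i complex.Re `|M i k|) * hnorm u)).
    apply: (le_trans (Re_norm_sum _)); rewrite mulr_suml; apply: ler_sum => i _.
    rewrite Re_normM mulrC; apply: ler_wpM2l; first exact: Re_norm_ge0.
    apply: (le_trans (hnorm_inner _ _)).
    suff -> : hnorm (e i) = 1 by rewrite mulr1.
    apply/eqP; rewrite -(eqrXn2 (n := 2)) ?hnorm_ge0// -rinner_hnorm /rinner.
    by rewrite oe.2 eqxx /= expr1n.
  rewrite lerDl mulr_ge0 ?hnorm_ge0//.
  by apply: sumr_ge0 => l _; apply: sumr_ge0 => i _; exact: Re_norm_ge0.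
Qed.

End Coordinates.

Section Bounds.
Context {R : realType} {H : hilbertType R} (A : operator H) (E : set R -> H -> H).
Hypotheses (Asa : self_adjoint A) (hE : is_spectral_measure A E).
Context (t : R).
Local Notation T := (shift A t%:C).
Implicit Types (u v z : H) (s : R).

Let domA := dom_submod A.

Lemma rinner_shift_expand s u :
  rinner (T u) (shift A s%:C u) = hnorm (T u) ^+ 2 + (t - s) * rinner (T u) u.
Proof. by rewrite (shiftE A s t) rinnerDr rinnerZr rinner_hnorm. Qed.

(** A projection of rank less than [j] kills some nonzero combination of the
    [y i], and on the kernel of [E (s, t)] the form is nonnegative. *)
Lemma lower_estimate (L : set H) s j (tau : R) (y : 'I_j -> H) :
  submod_closed [in L] -> L `<=` dom A -> L `&` ker A t%:C = [set 0] ->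
  (forall i, L (y i)) -> lin_indep y ->
  (forall c : 'I_j -> R[i], let u := \sum_i c i *: y i in
     rinner (T u) u <= tau * hnorm (T u) ^+ 2) ->
  s < t -> ~ (j%:R%:E <= Tr (E `]s, t[))%E -> 0 <= 1 + (t - s) * tau.
Proof.
move=> hL LA Lker Ly iy ytau st jTr.
have mI : measurable (`]s, t[%classic : set R) by exact: measurable_itv.
have [c [cE [i ci]]] : exists c : 'I_j -> R[i],
    \sum_i c i *: E `]s, t[ (y i) = 0 /\ exists i, c i != 0.
  apply: contrapT => h; apply: jTr; apply: ereal_sup_ubound.
  exists j => //; exists (fun i => E `]s, t[ (y i)); split.
    by move=> i; exists (y i).
  move=> c c0 i; apply: contrapT => /eqP ci; apply: h.
  by exists c; split=> //; exists i.
set u := \sum_i c i *: y i.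
have Lu : L u by exact: (subspace_sum hL).
have Eu : E `]s, t[ u = 0.
  rewrite -[RHS]cE; elim/big_rec2: (u) => [|k v w _ <-]; first exact: (proj_0 hE).
  by rewrite (projP hE).
have u0 : u != 0.
  by apply: contra_neq ci => /iy.
have Tu0 : T u != 0.
  by apply: contra_neq u0; exact: trial_inj LA Lker _ Lu.
have := rinner_shift_ge0 Asa hE st (LA _ Lu) Eu; rewrite rinner_shift_expand.
have := ytau c; rewrite -/u /= => h1 h2.
rewrite -(pmulr_lge0 _ (exprn_gt0 2 (hnorm_gt0 Tu0))).
have st0 : 0 < t - s by rewrite subr_gt0.
by have := ler_wpM2l (ltW st0) h1; lra.
Qed.

(** Inside [(s, t)] the form is nonpositive; outside, the components of [z] and
    of [z - u] coincide. *)
Lemma quasimode_form s u z eta : s < t -> E `]s, t[ u = u -> dom A z ->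
  hnorm (z - u) <= eta -> hnorm (T (z - u)) <= eta ->
  hnorm (T z) ^+ 2 + (t - s) * rinner (T z) z <= (1 + (t - s)) * eta ^+ 2.
Proof.
move=> st Eu dz e1 e2; rewrite -rinner_shift_expand.
have mI : measurable (`]s, t[%classic : set R) by exact: measurable_itv.
have mC := measurableC mI.
have du := dom_itv hE Eu.
have de : dom A (z - u) by exact: (subspaceB domA).
set p := E `]s, t[ z; set q := E (~` `]s, t[) z.
have dp : dom A p by exact: (dom_proj hE).
have dq : dom A q by exact: (dom_proj hE).
have Ep : E `]s, t[ p = p by exact: (spm_idem hE).
have zpq : z = p + q by rewrite (proj_compl hE).
have qe : q = E (~` `]s, t[) (z - u).
  by rewrite (projB hE)// ((proj_compl_eq0 hE u mI).1 Eu) subr0.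
have cross x : rinner (shift A x%:C p) (shift A (s + t - x)%:C q) = 0.
  by rewrite !(shift_proj Asa hE)// /rinner (inner_disjoint hE)// setICr.
have cross' x : rinner (shift A x%:C q) (shift A (s + t - x)%:C p) = 0.
  by rewrite !(shift_proj Asa hE)// /rinner (inner_disjoint hE)// setICl.
have split : rinner (T z) (shift A s%:C z) =
    rinner (T p) (shift A s%:C p) + rinner (T q) (shift A s%:C q).
  rewrite {1 2}zpq (lin_onD (shift_linear t))// (lin_onD (shift_linear s))//.
  rewrite rinnerDl !(rinnerDr _ (shift A s%:C p)).
  have := cross t; have := cross' t; rewrite addrK => -> ->.
  by rewrite addr0 add0r.
have hq : hnorm q <= eta by rewrite qe (le_trans (hnorm_proj_le hE _ mC)).
have hTq : hnorm (T q) <= eta.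
  by rewrite qe (shift_proj Asa hE)// (le_trans (hnorm_proj_le hE _ mC)).
rewrite split -[leRHS]add0r; apply: lerD; first exact: (rinner_shift_le0 Asa hE).
rewrite rinner_shift_expand [leRHS]mulrDl mul1r; apply: lerD.
  by rewrite ler_sqr ?nnegrE ?hnorm_ge0// (le_trans _ hq) ?hnorm_ge0.
apply: ler_wpM2l; first by rewrite subr_ge0 ltW.
apply: (le_trans (rinner_CS _ _)); rewrite expr2.
by apply: ler_pM => //; exact: hnorm_ge0.
Qed.

(** The part of [u] at distance less than [d] from [t] would lie in the gap. *)
Lemma gap_lower d s u : 0 < d -> (forall v, E `]t - d, t[ v = 0) ->
  E `]s, t[ u = u -> d * hnorm u <= hnorm (T u).
Proof.
move=> d0 gap Eu; have du := dom_itv hE Eu.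
have mI : measurable (`]s, t[%classic : set R) by exact: measurable_itv.
apply: (shift_lower Asa hE (ltW d0) du).
have mJ : measurable (`]t - d, t + d[%classic : set R) by exact: measurable_itv.
rewrite -Eu (proj_setI hE)//; apply: (proj_null_sub hE _ _ _ (gap u)).
- exact: measurable_itv.
- exact: measurableI.
- by move=> x [/=]; rewrite !in_itv/= => /andP[-> _] /andP[_ ->].
Qed.

(** With [l = t - s] the form gives [1 + l tau <= th], where [th] is of order
    [eta ^ 2]; the smallness of [eta] makes [th <= 1 / 2], so that [- 1 / tau]
    is at most [2 l] and dividing by [- tau] keeps the order. *)
Lemma upper_estimate d D eta s tau u z : 0 < d ->
  (forall v, E `]t - d, t[ v = 0) -> s < t -> t - s <= D ->
  E `]s, t[ u = u -> u != 0 -> dom A z ->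
  0 <= eta -> 4 * (1 + D) * eta <= d ->
  hnorm (z - u) <= eta * hnorm u -> hnorm (T (z - u)) <= eta * hnorm u ->
  tau < 0 -> tau * hnorm (T z) ^+ 2 <= rinner (T z) z ->
  s - (t + tau^-1) <= 8 * D * (1 + D) * eta ^+ 2 / d ^+ 2.
Proof.
move=> d0 gap st sD Eu u0 dz eta0 etad e1 e2 tau0 rz.
have du := dom_itv hE Eu; have de : dom A (z - u) by exact: (subspaceB domA).
have hu := hnorm_gt0 u0.
have := quasimode_form st Eu dz e1 e2; rewrite exprMn => h1.
have D0 : 0 < D by rewrite (lt_le_trans _ sD)// subr_gt0.
have etad' : eta <= d / 4 by nra.
have h2 : d / 2 * hnorm u <= hnorm (T z).
  have hd := gap_lower d0 gap Eu.
  have : hnorm (T u) <= hnorm (T z) + hnorm (T (z - u)).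
    rewrite (lin_onB domA (shift_linear t))//.
    by have := ler_hnormD (T u - T z) (T z); rewrite subrK hnormB_sym addrC.
  by nra.
have hz : 0 < hnorm (T z) by rewrite (lt_le_trans _ h2)// mulr_gt0// divr_gt0.
set N := hnorm (T z) ^+ 2 in h1 rz; have N0 : 0 < N by rewrite exprn_gt0.
have h3 : hnorm u ^+ 2 <= 4 / d ^+ 2 * N.
  rewrite mulrAC ler_pdivlMr ?exprn_gt0// /N.
  have : (d / 2 * hnorm u) ^+ 2 <= hnorm (T z) ^+ 2.
    by rewrite ler_sqr ?nnegrE ?hnorm_ge0// mulr_ge0 ?hnorm_ge0//; lra.
  by rewrite !exprMn => h; lra.
set l := t - s in h1 sD *; have l0 : 0 < l by rewrite subr_gt0.
pose th := 4 * (1 + D) * eta ^+ 2 / d ^+ 2.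
have h4 : 1 + l * tau <= th.
  rewrite -(ler_pM2r N0).
  apply: (@le_trans _ _ ((1 + l) * (eta ^+ 2 * hnorm u ^+ 2))).
    apply: le_trans h1; rewrite mulrDl mul1r lerD2l -mulrA.
    by apply: ler_wpM2l => //; exact: ltW.
  apply: (@le_trans _ _ ((1 + D) * (eta ^+ 2 * (4 / d ^+ 2 * N)))).
    apply: ler_pM; [lra|by rewrite mulr_ge0 ?sqr_ge0|lra|].
    by apply: ler_wpM2l => //; exact: sqr_ge0.
  rewrite le_eqVlt; apply/orP; left; apply/eqP; rewrite /th.
  by field; rewrite gt_eqF.
have th0 : 0 <= th.
  by rewrite /th divr_ge0 ?sqr_ge0// mulr_ge0 ?sqr_ge0//; lra.
have th1 : th <= 1 / 2.
  rewrite /th ler_pdivrMr ?exprn_gt0//.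
  have : (4 * (1 + D) * eta) ^+ 2 <= d ^+ 2.
    by rewrite ler_sqr ?nnegrE ?(ltW d0)// mulr_ge0//; lra.
  have : 0 <= eta ^+ 2 by exact: sqr_ge0.
  by rewrite !exprMn; nra.
have -> : 8 * D * (1 + D) * eta ^+ 2 / d ^+ 2 = 2 * D * th.
  by rewrite /th; ring.
have -> : s - (t + tau^-1) = (1 + l * tau) * (- tau)^-1.
  by rewrite /l; field; rewrite lt_eqF.
have nt0 : 0 < - tau by rewrite oppr_gt0.
rewrite ler_pdivrMr//.
have : 1 <= 2 * D * (- tau) by nra.
by nra.
Qed.

End Bounds.

(** * The error bound *)

Section Final.
Context {R : realType} {H : hilbertType R}.

Lemma Tr_zero j : (0 < j)%N -> ~ (j%:R%:E <= Tr (fun _ : H => 0%R : H))%E.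
Proof.
case: j => // j _ /dim_ge_indep[v [v0 iv]].
have := iv (fun=> 1); rewrite big1 => [/(_ erefl ord0)/eqP|i _].
  by rewrite oner_eq0.
by rewrite scale1r; case: (v0 i).
Qed.

Lemma le_sqrt_sum m (x y : 'I_m -> R) e k : (forall i, 0 <= x i) ->
  (forall i, 0 <= y i) -> Num.sqrt (\sum_i (x i ^+ 2 + y i ^+ 2)) <= e ->
  x k <= e /\ y k <= e.
Proof.
move=> x0 y0 he.
have le z : 0 <= z -> z ^+ 2 <= x k ^+ 2 + y k ^+ 2 -> z <= e.
  move=> z0 zk; apply: le_trans he; rewrite -(ger0_norm z0) -sqrtr_sqr.
  apply: ler_wsqrtr; apply: (le_trans zk); rewrite [leRHS](bigD1 k)//= lerDl.
  by apply: sumr_ge0 => i _; rewrite addr_ge0// sqr_ge0.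
by split; apply: le => //; rewrite ?lerDl ?lerDr sqr_ge0.
Qed.

Lemma hnorm_comb_le m (c : 'I_m -> R[i]) (x : 'I_m -> H) (K e : R) :
  (forall k, complex.Re `|c k| <= K) -> (forall k, hnorm (x k) <= e) ->
  hnorm (\sum_k c k *: x k) <= m%:R * (K * e).
Proof.
move=> cK xe; apply: (le_trans (ler_hnorm_sum _)).
rewrite -[m in m%:R]card_ord mulr_natl -sumr_const; apply: ler_sum => k _.
by rewrite hnormZ; apply: ler_pM; rewrite ?Re_norm_ge0 ?hnorm_ge0.
Qed.

End Final.

Theorem theorem15 (R : realType) (H : hilbertType R) (A : operator H)
    (a b : R) (m : nat) (phi : 'I_m -> H) (t : R) :
  self_adjoint A ->
  (forall lambda : R, lambda \in `]a, b[ ->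
     spectrum A lambda%:C -> discrete_spectrum A lambda%:C) ->
  (forall k, eigenvector A (phi k)) ->
  lin_span (range phi) = eigen_sum A `]a, b[ ->
  t \in `]a, b[ ->
  exists eps_t C : R, 0 < eps_t /\ 0 < C /\
    forall L : set H,
      submod_closed [in L] -> L `<=` dom A -> finite_dim L ->
      L `&` ker A t%:C = [set 0] ->
      forall (w : 'I_m -> H) (eps : R),
        (forall j, L (w j)) ->
        Num.sqrt (\sum_(j < m) (hnorm (w j - phi j) ^+ 2 +
                                tnorm A t (w j - phi j) ^+ 2)) <= eps ->
        eps < eps_t ->
        forall j : nat, (1 <= j <= n_minus A L t)%N ->
          (a%:E < nu_minus A j t < b%:E)%E ->
          0 <= fine (nu_minus A j t) - (t + (tau_minus A L t j)^-1)
            <= C * eps ^+ 2.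
Proof.
move=> Asa disc phi_eig phi_span tab.
have [[E0 hE0]|nE] := pselect (exists E, is_spectral_measure A E); last first.
  exists 1, 1; split=> //; split=> // L hL LA fL Lker w eps Lw hw epst j.
  move=> /andP[j1 jn].
  have -> : nu_minus A j t = -oo%E.
    apply/eqP; rewrite -leeNy_eq; apply: ge_ereal_sup => _ [s [_ h] <-].
    move: h; rewrite /spectral_projector xgetPN; last first.
      by move=> E hE; apply: nE; exists E.
    by move=> /(Tr_zero j1).
  by rewrite ltNge leNye.
set E := spectral_projector A.
have hE : is_spectral_measure A E by exact: (xgetPex _ (ex_intro _ E0 hE0)).
have [mu hmu] := eigenvalues_ex Asa phi_eig.
have [d d0 gap] := spectral_gap Asa hE disc phi_span hmu tab.
have [c [K [K0 clin cspan cbound]]] := bounded_coordinates phi.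
move: tab; rewrite in_itv/= => /andP[at' tb].
pose D := b - a; have D0 : 0 < D by rewrite subr_gt0 (lt_trans at').
pose M := m%:R * K + 1.
have M0 : 0 < M by rewrite ltr_wpDl// mulr_ge0.
(* [M * eps] bounds [|z - u|] and [|T (z - u)|] relative to [|u|]; below the
   threshold, [4 * (1 + D) * (M * eps) <= d] *)
exists (d / (4 * (1 + D) * M)), (8 * D * (1 + D) * M ^+ 2 / d ^+ 2).
split; first by rewrite divr_gt0// !mulr_gt0//; lra.
split; first by rewrite divr_gt0 ?exprn_gt0// !mulr_gt0 ?exprn_gt0//; lra.
move=> L hL LA fL Lker w eps Lw hw epst j hj nuab.
have [tau0 [y [Ly iy ytau]] xtau] := ritz_minmax Asa hL LA fL Lker hj.
set tau := tau_minus A L t j in tau0 ytau xtau *.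
have w_close k : hnorm (w k - phi k) <= eps /\ tnorm A t (w k - phi k) <= eps.
  by apply: le_sqrt_sum hw => i; exact: hnorm_ge0.
have eps0 : 0 <= eps by apply: le_trans hw; exact: sqrtr_ge0.
(* the bounds on [nu_minus] exclude the infinite values *)
have [nu nuE] : exists nu : R, nu_minus A j t = nu%:E.
  move: nuab; case: (nu_minus A j t) => [r _|/andP[_]|/andP[+ _]].
  - by exists r.
  - by rewrite ltNge leey.
  - by rewrite ltNge leNye.
rewrite nuE /= in nuab *; move: nuab; rewrite !lte_fin => /andP[anu nub].
have above s : s < t -> nu < s -> ~ (j%:R%:E <= Tr (E `]s, t[%classic))%E.
  move=> st nus jTr; suff : (s%:E <= nu%:E)%E by rewrite lee_fin leNgt nus.
  by rewrite -nuE; apply: ereal_sup_ubound; exists s.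
have below r : r < nu ->
    exists s, [/\ r < s, s < t & (j%:R%:E <= Tr (E `]s, t[%classic))%E].
  move=> rnu; have : (r%:E < nu_minus A j t)%E by rewrite nuE lte_fin.
  by move=> /ereal_sup_gt[_ [s [st jTr] <-]]; rewrite lte_fin => rs; exists s.
have itau0 : tau^-1 < 0 by rewrite invr_lt0.
apply/andP; split.
  rewrite subr_ge0 leNgt; apply/negP => lt_nu.
  pose s := (nu + (t + tau^-1)) / 2.
  have st : s < t by rewrite /s; lra.
  have nus : nu < s by rewrite /s; lra.
  have := lower_estimate Asa hE hL LA Lker Ly iy ytau st (above s st nus).
  have : (t - s) * tau < - 1.
    rewrite -ltrNr -mulrN -ltr_pdivrMr ?oppr_gt0// mul1r invrN /s.
    by lra.
  by lra.
rewrite leNgt; apply/negP; set B := (X in X < _) => ltB.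
(* [s] must stay in the interval for the range of [E (s, t)] to be spanned by
   the [phi k] *)
have [|s [rs st]] := below (Num.max a (t + tau^-1 + B)).
  by rewrite gt_max anu/=; lra.
move=> /dim_ge_indep[v [Ev iv]]; move: rs; rewrite gt_max => /andP[as' Bs].
have mI : measurable (`]s, t[%classic : set R) by exact: measurable_itv.
have Evi i : E `]s, t[%classic (v i) = v i.
  by have [u _ <-] := Ev i; exact: (spm_idem hE).
pose x i := \sum_k c k (v i) *: w k.
have Lx i : L (x i) by exact: (subspace_sum hL).
have [al [[i0 ali0] htau]] := xtau x Lx.
set u := \sum_i al i *: v i; set z := \sum_i al i *: x i in htau.
have Eu : E `]s, t[%classic u = u.
  rewrite /u; elim/big_rec: _ => [|i p _ Ep]; first exact: (proj_0 hE).
  by rewrite (projP hE)// Evi Ep.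
have u0 : u != 0 by apply: contra_neq ali0 => /iv.
have Su : lin_span (range phi) u.
  rewrite phi_span.
  exact: (range_proj_eigen_sum Asa hE disc phi_span hmu (ltW as') (ltW tb) Eu).
have zE : z = \sum_k c k u *: w k.
  rewrite /z /x; under eq_bigr do rewrite scaler_sumr.
  rewrite exchange_big /=; apply: eq_bigr => k _.
  by rewrite /u clin scaler_suml; apply: eq_bigr => i _; rewrite scalerA.
have eE : z - u = \sum_k c k u *: (w k - phi k).
  rewrite zE {2}(cspan u Su) -sumrB.
  by apply: eq_bigr => k _; rewrite scalerBr.
have domw k : dom A (w k - phi k).
  by apply: (subspaceB (dom_submod A)); [exact: LA|exact: (hmu k).1].
have bound (F : 'I_m -> H) : (forall k, hnorm (F k) <= eps) ->
    hnorm (\sum_k c k u *: F k) <= M * eps * hnorm u.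
  move=> Fe; apply: (le_trans (hnorm_comb_le (cbound^~ u) Fe)).
  rewrite /M mulrDl mul1r mulrDl.
  have := hnorm_ge0 u; have := mulr_ge0 eps0 (hnorm_ge0 u) => h1 h2.
  suff -> : m%:R * (K * hnorm u * eps) = m%:R * K * eps * hnorm u by lra.
  by ring.
have e1 : hnorm (z - u) <= M * eps * hnorm u.
  by rewrite eE; apply: bound => k; case: (w_close k).
have e2 : hnorm (shift A t%:C (z - u)) <= M * eps * hnorm u.
  rewrite eE (lin_on_sum (dom_submod A) (shift_linear t))//.
  by apply: bound => k; case: (w_close k).
have dz : dom A z by apply: LA; exact: (subspace_sum hL).
have := upper_estimate Asa hE d0 gap st (D := D) _ Eu u0 dz _ _ e1 e2 tau0 htau.
move=> /(_ _ _ _)/wrap[].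
- by rewrite /D; lra.
- by rewrite mulr_ge0// ltW.
- move: epst; rewrite ltr_pdivlMr; last by rewrite !mulr_gt0//; lra.
  by move=> h; apply: ltW; lra.
have -> : 8 * D * (1 + D) * (M * eps) ^+ 2 / d ^+ 2 = B by rewrite /B; ring.
by lra.
Qed.
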